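(* Let $m\ge1$, $I\subset\{0,\dots,m\}$ nonempty, and $\mu\in X_*$ any cocharacter of $GSp_{2m}$. Then $\mathrm{Adm}_{GSp_{2m},I}(\mu)=\mathrm{Perm}_{GL_{2m},\pm I}(\mu)\cap\widetilde W/W_I$, where $\widetilde W/W_I$ is regarded as a subset of $\widetilde W_{GL_{2m}}/W_{GL_{2m},\pm I}$.
   Context: Notation: $(x^{(p)},y^{(q)})$ is $x$ repeated $p$ times then $y$ repeated $q$ times; $\mathbf b=(b,\dots,b)$. GL side: $\widetilde W_{GL_{2m}}=\mathbb Z^{2m}\rtimes S_{2m}$ acting on $\mathbb R^{2m}$ by affine transformations ($t_\lambda\sigma:x\mapsto\lambda+\sigma x$, $S_{2m}$ permuting coordinates). For $i=2mb+c$, $0\le c<2m$, $\omega_i=((-1)^{(c)},0^{(2m-c)})-\mathbf b$. $W_{GL_{2m},\pm I}$ is the stabilizer in $\widetilde W_{GL_{2m}}$ of all $\omega_i$ with $i\in2m\mathbb Z\pm I$ (integers congruent mod $2m$ to an element of $I\cup(-I)$). $\mathrm{Perm}_{GL_{2m},\pm I}(\mu)$ is the set of $\tilde w\in\widetilde W_{GL_{2m}}/W_{GL_{2m},\pm I}$ such that $\tilde w\cdot\omega_i-\omega_i\in\mathrm{Conv}(S_{2m}\mu)$ for all $i\in2m\mathbb Z\pm I$, where $\mathrm{Conv}(S_{2m}\mu)$ is the convex hull in $\mathbb R^{2m}$ of the $S_{2m}$-orbit of $\mu$. GSp side: $X_*=\{x\in\mathbb Z^{2m}:x_1+x_{2m}=\dots=x_m+x_{m+1}\}$,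 $V=X_*\otimes\mathbb R$, $S_{2m}^*=\{\sigma\in S_{2m}:\sigma(2m+1-j)=2m+1-\sigma(j)\ \forall j\}$, $\widetilde W=X_*\rtimes S_{2m}^*\subset\widetilde W_{GL_{2m}}$; affine Weyl group $W_a$ generated by the affine reflections of $V$ in $\widetilde W$ across the zero loci in $V$ of $x_i-x_j-k$ ($i<j$, $k\in\mathbb Z$); base alcove $A=\{x\in V:x_{2m}-1<x_1<\dots<x_m<x_{m+1}\}$ with stabilizer $\Omega$, $\widetilde W=W_a\rtimes\Omega$; Bruhat order: Coxeter Bruhat order on $W_a$ (simple reflections = reflections across walls of $A$), extended by $x\omega\le x'\omega'$ iff $\omega=\omega'$ and $x\le x'$. $W_I$ is the stabilizer in $\widetilde W$ of all $\omega_i$, $i\in2m\mathbb Z\pm I$; $W_I=\widetilde W\cap W_{GL_{2m},\pm I}$, so $\widetilde W/W_I$ injects into $\widetilde W_{GL_{2m}}/W_{GL_{2m},\pm I}$. Bruhat order on $\widetilde W/W_I$ via minimal-length representatives. $\mathrm{Adm}_{GSp_{2m},I}(\mu)$ is the set of $w\in\widetilde W/W_I$ with $w\le t_{\sigma\mu}W_I$ for some $\sigma\in S_{2m}^*$. *)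

(* Defs.v *)
From HB Require Import structures.
From mathcomp Require Import all_boot all_order all_algebra all_fingroup.
From mathcomp Require Import Rstruct.
From Stdlib Require Import Rdefinitions.

Set Implicit Arguments.
Unset Strict Implicit.
Unset Printing Implicit Defensive.

Import Order.TTheory GRing.Theory Num.Theory.
Local Open Scope ring_scope.

(* Extended affine Weyl group of GL_n :  Z^n x| S_n  (n = 2m later)    *)

Definition vec (n : nat) := {ffun 'I_n -> int}.
Definition elt (n : nat) := (vec n * {perm 'I_n})%type.

Definition permv n (s : {perm 'I_n}) (x : vec n) : vec n :=
  [ffun i => x (s^-1 i)%g].

Definition act n (w : elt n) (x : vec n) : vec n :=
  [ffun i => w.1 i + x (w.2^-1 i)%g].

Definition actR n (w : elt n) (x : 'I_n -> R) : 'I_n -> R :=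
  fun i => ((w.1 i)%:~R + x (w.2^-1 i)%g)%R.

(* group law: act (mul w w') = act w \o act w' *)
Definition mul n (w w' : elt n) : elt n :=
  ([ffun i => w.1 i + w'.1 (w.2^-1 i)%g], (w'.2 * w.2)%g).

Definition one n : elt n := ([ffun => 0], 1%g).

Definition prodw n (s : seq (elt n)) : elt n := foldr (@mul n) (one n) s.

Definition transl n (lam : vec n) : elt n := (lam, 1%g).

Definition omega n (i : int) : vec n :=
  [ffun j : 'I_n => (if ((j : nat)%:Z < modz i n%:Z) then -1 else 0)
                    - divz i n%:Z].

Definition inPMI (m : nat) (I : {set 'I_m.+1}) (i : int) : Prop :=
  exists2 k : 'I_m.+1, k \in I &
    (modz i (m.*2)%:Z = modz (k : nat)%:Z (m.*2)%:Z \/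
     modz i (m.*2)%:Z = modz (- (k : nat)%:Z) (m.*2)%:Z).

Definition stabGL (m : nat) (I : {set 'I_m.+1}) (u : elt m.*2) : Prop :=
  forall i, inPMI I i -> act u (omega m.*2 i) = omega m.*2 i.

Definition inConv n (mu v : vec n) : Prop :=
  exists c : {perm 'I_n} -> R,
    (forall s, 0 <= c s) /\ \sum_(s : {perm 'I_n}) c s = 1 /\
    forall j, (v j)%:~R = \sum_(s : {perm 'I_n}) c s * (permv s mu j)%:~R.

(* the coset w W_{GL,+-I} lies in Perm_{GL_{2m},+-I}(mu) *)
Definition PermGL (m : nat) (I : {set 'I_m.+1}) (mu : vec m.*2)
    (w : elt m.*2) : Prop :=
  forall i, inPMI I i ->
    inConv mu [ffun j => act w (omega m.*2 i) j - omega m.*2 i j].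

Definition inX n (x : vec n) : Prop :=
  forall j k : 'I_n, x j + x (rev_ord j) = x k + x (rev_ord k).

Definition inV n (x : 'I_n -> R) : Prop :=
  forall j k : 'I_n, (x j + x (rev_ord j) = x k + x (rev_ord k))%R.

Definition inSstar n (s : {perm 'I_n}) : Prop :=
  forall j, s (rev_ord j) = rev_ord (s j).

Definition inWt n (w : elt n) : Prop := inX w.1 /\ inSstar w.2.

(* w is the affine reflection of V, in W~, across the zero locus in V
   of x_i - x_j - k : a non-trivial involution of W~ fixing that locus
   pointwise. *)
Definition isRefl n (i j : 'I_n) (k : int) (w : elt n) : Prop :=
  inWt w /\ mul w w = one n /\ w <> one n /\
  forall x : 'I_n -> R, inV x -> (x i - x j = k%:~R)%R ->
    forall l, actR w x l = x l.

Definition affRefl n (w : elt n) : Prop :=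
  exists (i j : 'I_n) (k : int), ltn i j /\ isRefl i j k w.

Definition inWa n (w : elt n) : Prop :=
  exists s : seq (elt n), (forall t, t \in s -> affRefl t) /\ prodw s = w.

(* base alcove A = { x in V : x_{2m} - 1 < x_1 < ... < x_m < x_{m+1} }
   (0-indexed: x_{2m-1} - 1 < x_0 < x_1 < ... < x_m) *)
Definition inA (m : nat) (x : 'I_m.*2 -> R) : Prop :=
  inV x /\
  (forall a b : 'I_m.*2, (a : nat) = 0%N -> (b : nat) = (m.*2).-1 ->
       (x b - 1 < x a)%R) /\
  (forall a b : 'I_m.*2, (b : nat) = a.+1 -> leq b m -> (x a < x b)%R).

(* simple reflections: reflections across the walls of A, i.e. the
   hyperplanes x_1 - x_{2m} = -1 and x_j - x_{j+1} = 0 (1 <= j <= m) *)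
Definition simpleRefl (m : nat) (w : elt m.*2) : Prop :=
  exists a b : 'I_m.*2,
    ((a : nat) = 0%N /\ (b : nat) = (m.*2).-1 /\ isRefl a b (-1) w) \/
    ((b : nat) = a.+1 /\ leq b m /\ isRefl a b 0 w).

Definition inOmega (m : nat) (w : elt m.*2) : Prop :=
  inWt w /\ forall x : 'I_m.*2 -> R, inV x -> (inA x <-> inA (actR w x)).

Definition simpleWord (m : nat) (s : seq (elt m.*2)) : Prop :=
  forall t, t \in s -> simpleRefl t.

Definition reducedWord (m : nat) (s : seq (elt m.*2)) : Prop :=
  simpleWord s /\
  forall s', simpleWord s' -> prodw s' = prodw s -> leq (size s) (size s').

Definition bruhatWa (m : nat) (x y : elt m.*2) : Prop :=
  exists (s : seq (elt m.*2)) (b : bitseq),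
    reducedWord s /\ prodw s = y /\ prodw (mask b s) = x.

(* Bruhat order on W~ = W_a x| Omega *)
Definition bruhat (m : nat) (w w' : elt m.*2) : Prop :=
  exists x x' o : elt m.*2,
    [/\ inWa x, inWa x', inOmega o, w = mul x o /\ w' = mul x' o
      & bruhatWa x x'].

Definition lengthW (m : nat) (w : elt m.*2) (l : nat) : Prop :=
  exists x o : elt m.*2,
    [/\ inWa x, inOmega o, w = mul x o &
        exists s, reducedWord s /\ prodw s = x /\ size s = l].

Definition inWI (m : nat) (I : {set 'I_m.+1}) (u : elt m.*2) : Prop :=
  inWt u /\ stabGL I u.

Definition inCoset (m : nat) (I : {set 'I_m.+1}) (w u : elt m.*2) : Prop :=
  exists2 v, inWI I v & u = mul w v.

Definition minRep (m : nat) (I : {set 'I_m.+1}) (w x : elt m.*2) : Prop :=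
  inCoset I w x /\
  exists l, lengthW x l /\
    forall y l', inCoset I w y -> lengthW y l' -> leq l l'.

Definition bruhatI (m : nat) (I : {set 'I_m.+1}) (w v : elt m.*2) : Prop :=
  exists x y, [/\ minRep I w x, minRep I v y & bruhat x y].

(* the coset w W_I lies in Adm_{GSp_{2m},I}(mu) *)
Definition Adm (m : nat) (I : {set 'I_m.+1}) (mu : vec m.*2)
    (w : elt m.*2) : Prop :=
  exists2 s : {perm 'I_m.*2}, inSstar s & bruhatI I w (transl (permv s mu)).

(* Main.v *)
(* Elements of the extended affine Weyl group are affine permutations of the
   integers; the base alcove and the hyperplanes become congruence data on
   their windows, and y lies above x in the Bruhat order when y = r x for a
   reflection r whose hyperplane separates A from yA.

   Admissible implies permissible: such a reflection moves each vertex of yA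
   towards the corresponding vertex of A along a coroot, hence stays in the
   convex hull.

   Permissible implies admissible: let w be permissible and choose a Weyl
   chamber containing the displacement under w of an interior point of A.  Seen
   from a point deep in the opposite chamber, the Bruhat order becomes the
   semi-infinite order, and since no hyperplane separates A both from that
   point and from wA, an inequality between w and any y in the semi-infinite
   order implies the same inequality in the Bruhat order (ble_strip).  The
   permissibility of w says that, vertex by vertex, w is dominated by the
   translation t_lambda, where lambda is the conjugate of mu dominant for the
   chosen chamber.  A tableau criterion (dom_raise) turns this into a chain of
   reflections from w to t_lambda W_I. *)
From Stdlib Require Import Rdefinitions Classical_Prop.
From HB Require Import structures.
From mathcomp Require Import all_boot all_order all_algebra all_fingroup.
From mathcomp Require Import Rstruct zify ring lra.
Require Import Defs.
Set Implicit Arguments.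
Unset Strict Implicit.
Unset Printing Implicit Defensive.
Import Order.TTheory GRing.Theory Num.Theory.
Local Open Scope ring_scope.

(** * The extended affine Weyl group acting on windows *)

(** In the semi-infinite order the direction of a reflection depends only on its finite root, so a
    raising argument has to control prefix sums and never the position relative to [A]; this is why
    the comparison is made far away and then carried back. The convex hull enters through
    majorization alone: any [l] coordinates of a permissible displacement sum to at most the [l]
    largest entries of [mu], so one sorting permutation, taken from the displacement of the base
    point, serves all vertices at once. The obstacle is the symplectic duality: a reflection not in
    a long root exchanges two pairs of coordinates, [(a, b)] and its mirror image, and the second
    exchange may break the domination that the first one respects. Duality also helps: it ties
    prefixes of length [l] at the vertex [i] to those of length [n - l] at [- i], which is where
    stability of the index set under negation enters. Squared distance from the base point replaces
    length in the inductions, so that no inversions are counted. *)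

Lemma small_multiple_eq0 (N k x : int) : x = N * k -> - N < x -> x < N -> k = 0.
Proof. nia. Qed.

Lemma nat_least (P : nat -> Prop) : (exists k, P k) ->
  exists k, P k /\ forall k', P k' -> (k <= k')%N.
Proof.
move=> [k hk]; apply: NNPP => h.
suff : forall k', ~ P k' by move/(_ k).
move=> k'; elim/ltn_ind: k' => k' IH hk'; apply: h; exists k'; split=> // k2 hk2.
by rewrite leqNgt; apply/negP => /IH.
Qed.

Lemma ord_least n (P : 'I_n -> Prop) : (exists c, P c) ->
  exists c : 'I_n, P c /\ forall c' : 'I_n, (c' < c)%N -> ~ P c'.
Proof.
move=> [c hc].
have [v [[c1 hc1 e1] h]] := @nat_least (fun v => exists2 c : 'I_n, P c & (c : nat) = v) (ex_intro _ _ (ex_intro2 _ _ c hc erefl)).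
by exists c1; split=> // c' lt hc'; have := h c' (ex_intro2 _ _ c' hc' erefl); lia.
Qed.

Lemma sum_delta n (a : 'I_n) (l : nat) (t : int) : \sum_(c < n | (c < l)%N) (c == a)%:R * t = (a < l)%N%:R * t.
Proof.
case: ltnP => h.
  by rewrite (bigD1 a) //= eqxx big1 ?addr0 // => c /andP [_ /negbTE ->]; rewrite mul0r.
rewrite big1 ?mul0r // => c cl; case: eqP => [e|_]; last by rewrite mul0r.
by rewrite -e in h; lia.
Qed.

Section ExtendedAffineWeylGroup.
Variable m : nat.
Local Notation n := (m.*2).
Implicit Types (x y z w u v o : elt n) (i j l a b : 'I_n) (k c : int).

Definition inv w : elt n := ([ffun i => - w.1 (w.2 i)], (w.2^-1)%g).

Lemma mulA x y z : mul x (mul y z) = mul (mul x y) z.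
Proof.
congr pair; last by rewrite /= mulgA.
by apply/ffunP=> i; rewrite !ffunE /= addrA invMg permM.
Qed.

Lemma mul1w w : mul (one n) w = w.
Proof.
case: w => [f s]; congr pair; last by rewrite /= mulg1.
by apply/ffunP=> i; rewrite !ffunE /= add0r invg1 perm1.
Qed.

Lemma mulw1 w : mul w (one n) = w.
Proof.
case: w => [f s]; congr pair; last by rewrite /= mul1g.
by apply/ffunP=> i; rewrite !ffunE /= addr0.
Qed.

Lemma mulVw w : mul (inv w) w = one n.
Proof.
case: w => [f s]; congr pair; last by rewrite /= mulgV.
by apply/ffunP=> i; rewrite !ffunE /= invgK addNr.
Qed.

Lemma mulwV w : mul w (inv w) = one n.
Proof.
case: w => [f s]; congr pair; last by rewrite /= mulVg.
by apply/ffunP=> i; rewrite !ffunE /= permKV addrN.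
Qed.

Lemma mulKw u w : mul (inv u) (mul u w) = w.
Proof. by rewrite mulA mulVw mul1w. Qed.

Lemma mulKVw u w : mul u (mul (inv u) w) = w.
Proof. by rewrite mulA mulwV mul1w. Qed.

Lemma mulwK u w : mul (mul w u) (inv u) = w.
Proof. by rewrite -mulA mulwV mulw1. Qed.

Lemma mulwKV u w : mul (mul w (inv u)) u = w.
Proof. by rewrite -mulA mulVw mulw1. Qed.

Lemma mulIw u x y : mul u x = mul u y -> x = y.
Proof. by move=> e; rewrite -(mulKw u x) e mulKw. Qed.

Lemma invM x y : inv (mul x y) = mul (inv y) (inv x).
Proof. by apply: (@mulIw (mul x y)); rewrite mulwV mulA mulwK mulwV. Qed.

Lemma invK w : inv (inv w) = w.
Proof. by apply: (@mulIw (inv w)); rewrite mulwV mulVw. Qed.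

Lemma act_mul x y (v : vec n) : act (mul x y) v = act x (act y v).
Proof. by apply/ffunP=> i; rewrite !ffunE /= invMg permM addrA. Qed.

Lemma act_one (v : vec n) : act (one n) v = v.
Proof. by apply/ffunP=> i; rewrite !ffunE /= invg1 perm1 add0r. Qed.

Lemma Sstar_inv (s : {perm 'I_n}) : inSstar s -> inSstar (s^-1)%g.
Proof. by move=> h j; apply: (@perm_inj _ s); rewrite h !permKV. Qed.

Lemma Sstar_mul (s t : {perm 'I_n}) : inSstar s -> inSstar t -> inSstar (s * t)%g.
Proof. by move=> hs ht j; rewrite !permM hs ht. Qed.

Lemma Wt_one : inWt (one n).
Proof. by split=> [i j|j]; rewrite ?ffunE //= !perm1. Qed.

Lemma Wt_mul x y : inWt x -> inWt y -> inWt (mul x y).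
Proof.
move=> [hx1 hx2] [hy1 hy2]; split; last exact: Sstar_mul.
move=> i j; rewrite !ffunE !(Sstar_inv hx2) addrACA [RHS]addrACA.
by rewrite (hx1 i j) (hy1 _ ((x.2^-1)%g j)).
Qed.

Lemma Wt_inv x : inWt x -> inWt (inv x).
Proof.
move=> [h1 h2]; split; last exact: Sstar_inv.
by move=> i j; rewrite !ffunE !h2 -!opprD (h1 _ (x.2 j)).
Qed.

Lemma Wt_transl (f : vec n) : inX f -> inWt (transl f).
Proof. by move=> h; split=> // j; rewrite !perm1. Qed.

Lemma rev_ordE i : (rev_ord i : nat)%:Z = n%:Z - 1 - (i : nat)%:Z.
Proof. by rewrite /=; have := ltn_ord i; lia. Qed.

Lemma rev_ord_neq i : rev_ord i != i.
Proof. by apply/eqP=> /(congr1 val) /=; have := ltn_ord i; lia. Qed.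

(* [pt w] is the window of [w] seen as an affine permutation of [int]; up to
   scaling it is the image under [w] of the point [(0, 1/n, ..., (n-1)/n)] of
   the base alcove. *)
Definition pt w i : int := n%:Z * w.1 i + ((w.2^-1)%g i : nat)%:Z.

Definition ev i j k w : int := pt w i - pt w j - n%:Z * k.

Lemma pt_mul x y i : pt (mul x y) i = n%:Z * x.1 i + pt y ((x.2^-1)%g i).
Proof. by rewrite /pt /= ffunE invMg permM mulrDr addrA. Qed.

Lemma pt_one i : pt (one n) i = (i : nat)%:Z.
Proof. by rewrite /pt /= ffunE invg1 perm1 mulr0 add0r. Qed.

Lemma pt_rev w i j : inWt w ->
  pt w i + pt w (rev_ord i) = n%:Z * (w.1 j + w.1 (rev_ord j)) + n%:Z - 1.
Proof.
move=> [h1 h2]; rewrite /pt (Sstar_inv h2) rev_ordE -(h1 i j); ring.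
Qed.

Lemma pt_dual w i j : inWt w -> pt w i + pt w (rev_ord i) = pt w j + pt w (rev_ord j).
Proof. by move=> h; rewrite !(@pt_rev w _ i). Qed.

Lemma pt_modn w i j k : pt w i = pt w j + n%:Z * k -> i = j.
Proof.
rewrite /pt => h; apply: (@perm_inj _ (w.2^-1)%g); apply/ord_inj.
set p := (w.2^-1)%g i in h *; set q := (w.2^-1)%g j in h *.
have hp := ltn_ord p; have hq := ltn_ord q.
have e : p%:Z - q%:Z = n%:Z * (w.1 j + k - w.1 i).
  by apply/eqP; rewrite subr_eq; apply/eqP; rewrite -(addKr (n%:Z * w.1 i) p%:Z) h; ring.
have h0 : w.1 j + k - w.1 i = 0 by apply: small_multiple_eq0 e _ _; lia.
by move: e; rewrite h0 mulr0; lia.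
Qed.

Lemma pt_inj x y : (forall i, pt x i = pt y i) -> x = y.
Proof.
move=> h.
have e i : x.1 i = y.1 i /\ (x.2^-1)%g i = (y.2^-1)%g i.
  have := h i; rewrite /pt.
  set p := (x.2^-1)%g i; set q := (y.2^-1)%g i => e.
  have hp := ltn_ord p; have hq := ltn_ord q.
  have e' : p%:Z - q%:Z = n%:Z * (y.1 i - x.1 i).
    by rewrite mulrBr; move: e; lia.
  have h0 : y.1 i - x.1 i = 0 by apply: small_multiple_eq0 e' _ _; lia.
  rewrite h0 mulr0 in e'; split; [lia|apply/ord_inj; lia].
have e1 : x.1 = y.1 by apply/ffunP => i; case: (e i).
have e2 : x.2 = y.2 by apply: invg_inj; apply/permP=> i; case: (e i).
by case: x y e1 e2 {e h} => [? ?] [? ?] /= -> ->.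
Qed.

Lemma ev_neq0 i j k w : i != j -> ev i j k w != 0.
Proof.
move=> /eqP h; apply/eqP=> e; apply: h; apply: (@pt_modn w _ _ k).
by move: e; rewrite /ev; lia.
Qed.

Lemma ev_opp i j k w : ev j i (- k) w = - ev i j k w.
Proof. by rewrite /ev; ring. Qed.

Lemma ev_dual i j k w : inWt w -> ev (rev_ord j) (rev_ord i) k w = ev i j k w.
Proof. by move=> h; rewrite /ev; have := pt_dual i j h; lia. Qed.

Lemma ev_mul x y i j k :
  ev (x.2 i) (x.2 j) (k + x.1 (x.2 i) - x.1 (x.2 j)) (mul x y) = ev i j k y.
Proof. by rewrite /ev !pt_mul !permK; ring. Qed.

Lemma ev_one i j k : ev i j k (one n) = (i : nat)%:Z - (j : nat)%:Z - n%:Z * k.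
Proof. by rewrite /ev !pt_one. Qed.

(* coordinates of the coroot of [x_i - x_j] in [X_*] *)
Definition coroot i j l : int :=
  (l == i)%:R - (l == j)%:R +
  (if j == rev_ord i then 0 else (l == rev_ord j)%:R - (l == rev_ord i)%:R).

Definition rperm i j : {perm 'I_n} :=
  if j == rev_ord i then tperm i j
  else (tperm i j * tperm (rev_ord i) (rev_ord j))%g.

Definition refl i j k : elt n := ([ffun l => k * coroot i j l], rperm i j).

Lemma rev_ord_eq i j : (rev_ord i == rev_ord j) = (i == j).
Proof. by rewrite (inj_eq rev_ord_inj). Qed.

Lemma rev_ord_eqC i j : (rev_ord i == j) = (i == rev_ord j).
Proof. by rewrite -rev_ord_eq rev_ordK. Qed.

Lemma sum_coroot (T : pzRingType) (F : 'I_n -> T) i j :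
  \sum_l F l * (coroot i j l)%:~R =
  F i - F j + (if j == rev_ord i then 0 else F (rev_ord j) - F (rev_ord i)).
Proof.
have ind (a : 'I_n) : \sum_l F l * ((l == a)%:R : int)%:~R = F a.
  rewrite (bigD1 a) //= eqxx mulr1 big1 ?addr0 // => l /negbTE ->.
  by rewrite mulr0.
under eq_bigr do rewrite /coroot intrD intrB mulrDr mulrBr.
rewrite big_split sumrB !ind; congr (_ + _).
case: ifP => _; first by rewrite big1 // => l _; rewrite mulr0.
by under eq_bigr do rewrite intrB mulrBr; rewrite sumrB !ind.
Qed.

Lemma rperm_involutive i j : involutive (rperm i j).
Proof.
move=> l; rewrite /rperm; case: eqP => [_|h]; first exact: tpermK.
have c : (tperm i j * tperm (rev_ord i) (rev_ord j) =
          tperm (rev_ord i) (rev_ord j) * tperm i j)%g.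
  have h1 : i != rev_ord j by apply/eqP=> e; apply: h; rewrite e rev_ordK.
  have h2 : j != rev_ord i by apply/eqP=> e; apply: h.
  rewrite [RHS]conjgC tpermJ !tpermD // ?[_ == rev_ord _]eq_sym ?rev_ord_neq //.
by rewrite -permM {1}c mulgA -(mulgA (tperm _ _)) tperm2 mulg1 tperm2 perm1.
Qed.

Lemma rpermV i j : ((rperm i j)^-1 = rperm i j)%g.
Proof. by apply/permP=> l; apply: (@perm_inj _ (rperm i j)); rewrite permKV rperm_involutive. Qed.

(** The constancy hypothesis forces [F i - F j = F (rev_ord j) - F (rev_ord i)], so one difference
    corrects both transposed pairs. The ring is arbitrary because the formula serves for windows,
    for indices and for real points. *)
Lemma reflection_formula (T : pzRingType) (F : 'I_n -> T) i j l :
  (forall a b, F a + F (rev_ord a) = F b + F (rev_ord b)) -> i != j ->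
  F (rperm i j l) = F l - (F i - F j) * (coroot i j l)%:~R.
Proof.
move=> hF ij; rewrite /rperm /coroot.
have d : F i - F j = F (rev_ord j) - F (rev_ord i).
  have := hF i j => e; rewrite -[F i](addrK (F (rev_ord i))) e.
  by rewrite addrAC [F j + _]addrC addrK.
have hi := rev_ord_neq i; have hj := rev_ord_neq j.
case: eqP => [e|/eqP h].
  rewrite addr0; case: tpermP => [->|->|/eqP/negbTE -> /eqP/negbTE ->].
  - by rewrite eqxx (negbTE ij) subr0 mulr1 opprB addrC subrK.
  - by rewrite eqxx eq_sym (negbTE ij) sub0r mulrN1 opprK addrC subrK.
  by rewrite subrr mulr0 subr0.
have h1 : rev_ord i == j = false by rewrite eq_sym (negbTE h).
have h2 : rev_ord j == i = false by rewrite rev_ord_eqC (negbTE h).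
have ij' : rev_ord i == rev_ord j = false by rewrite rev_ord_eq (negbTE ij).
have h3 : i == rev_ord j = false by rewrite eq_sym.
have ji : j == i = false by rewrite eq_sym (negbTE ij).
have hi' : i == rev_ord i = false by rewrite eq_sym (negbTE hi).
have hj' : j == rev_ord j = false by rewrite eq_sym (negbTE hj).
rewrite permM; case: (tpermP i j l) => [->|->|/eqP/negbTE li /eqP/negbTE lj].
- rewrite tpermD ?h1 ?hj // eqxx (negbTE ij) h3 hi'.
  by rewrite [X in X%:~R](_ : _ = 1) // mulr1 opprB addrC subrK.
- rewrite tpermD ?h2 ?hi // ji eqxx (negbTE h) hj'.
  by rewrite [X in X%:~R](_ : _ = -1) // mulrN1 opprK addrC subrK.
rewrite li lj subrr add0r.
case: tpermP => [->|->|/eqP/negbTE -> /eqP/negbTE ->].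
- by rewrite ij' eqxx [X in X%:~R](_ : _ = -1) // mulrN1 opprK d addrC subrK.
- by rewrite eqxx rev_ord_eq ji [X in X%:~R](_ : _ = 1) // mulr1 d opprB addrC subrK.
by rewrite subrr mulr0 subr0.
Qed.

Lemma pt_refl i j k w l : inWt w -> i != j ->
  pt (mul (refl i j k) w) l = pt w l - ev i j k w * coroot i j l.
Proof.
move=> hw ij; rewrite pt_mul /= ffunE rpermV.
rewrite (reflection_formula (F := pt w)) //; last by move=> a b; exact: pt_dual.
by rewrite /ev intz; ring.
Qed.

Lemma coroot_rev i j l : i != j -> coroot i j (rev_ord l) = - coroot i j l.
Proof.
move=> ij; rewrite /coroot; case: (j =P _) => [->|_].
  by rewrite !addr0 rev_ord_eqC rev_ord_eq opprB.
rewrite !rev_ord_eq !rev_ord_eqC; ring.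
Qed.

Lemma Wt_refl i j k : i != j -> inWt (refl i j k).
Proof.
move=> ij; split.
  by move=> a b; rewrite !ffunE !coroot_rev // !mulrN !subrr.
move=> l; apply/ord_inj.
(* The index function itself satisfies the duality relation, so the reflection formula computes the
   permutation [rperm i j]. *)
have F a b : ((a : nat)%:Z + (rev_ord a : nat)%:Z = (b : nat)%:Z + (rev_ord b : nat)%:Z).
  by rewrite !rev_ordE; ring.
have h a := reflection_formula (F := fun a : 'I_n => (a : nat)%:Z) a F ij.
suff : ((rperm i j (rev_ord l) : nat)%:Z = (rev_ord (rperm i j l) : nat)%:Z) by move=> [].
by rewrite rev_ordE !h coroot_rev // rev_ordE mulrNz; ring.
Qed.

End ExtendedAffineWeylGroup.

(** * Reflections and the Bruhat order by hyperplanes *)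

Section BruhatOrder.
Variable m : nat.
Local Notation n := (m.*2).
Implicit Types (x y z w u v o : elt n) (i j l a b : 'I_n) (k c : int).

Lemma coroot_l i j : i != j -> coroot i j i = 1.
Proof.
move=> ij; rewrite /coroot eqxx (negbTE ij); case: (j =P _) => [//|/eqP h].
have -> : i == rev_ord j = false by rewrite -rev_ord_eqC eq_sym (negbTE h).
by rewrite eq_sym (negbTE (rev_ord_neq i)).
Qed.

Lemma coroot_opp i j l : coroot j i l = - coroot i j l.
Proof.
rewrite /coroot -(rev_ord_eqC i j) [rev_ord i == j]eq_sym.
by case: (j =P rev_ord i) => _; ring.
Qed.

Lemma coroot_r i j : i != j -> coroot i j j = -1.
Proof. by move=> ij; rewrite coroot_opp coroot_l // eq_sym. Qed.

Lemma coroot_dual i j l : coroot (rev_ord j) (rev_ord i) l = coroot i j l.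
Proof.
rewrite /coroot rev_ord_eq !rev_ordK -(rev_ord_eqC i j) [rev_ord i == j]eq_sym.
by case: (j =P rev_ord i) => [->|_]; rewrite ?rev_ordK; ring.
Qed.

Lemma coroot_perm (s : {perm 'I_n}) i j l :
  inSstar s -> coroot (s i) (s j) (s l) = coroot i j l.
Proof. by move=> h; rewrite /coroot -!h !(inj_eq perm_inj). Qed.

Lemma refl_opp i j k : i != j -> refl j i (- k) = refl i j k.
Proof.
move=> ij; rewrite -[LHS]mulw1 -[RHS]mulw1; apply: pt_inj => l.
have ji : j != i by rewrite eq_sym.
have h1 := @Wt_one m.
by rewrite !pt_refl // ev_opp coroot_opp; ring.
Qed.

Lemma refl_dual i j k : i != j -> refl (rev_ord j) (rev_ord i) k = refl i j k.
Proof.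
move=> ij; rewrite -[LHS]mulw1 -[RHS]mulw1; apply: pt_inj => l.
have h1 := @Wt_one m.
by rewrite !pt_refl ?ev_dual ?coroot_dual // rev_ord_eq eq_sym.
Qed.

Lemma ev_refl i j k w : inWt w -> i != j ->
  ev i j k (mul (refl i j k) w) = - ev i j k w.
Proof.
by move=> hw ij; rewrite {1}/ev !pt_refl // coroot_l // coroot_r // /ev; ring.
Qed.

Lemma reflK i j k w : inWt w -> i != j -> mul (refl i j k) (mul (refl i j k) w) = w.
Proof.
move=> hw ij; have hr := Wt_mul (Wt_refl k ij) hw.
by apply: pt_inj => l; rewrite !pt_refl // ev_refl //; ring.
Qed.

Lemma inv_refl i j k : i != j -> inv (refl i j k) = refl i j k.
Proof.
move=> ij; apply: (@mulIw _ (refl i j k)); rewrite mulwV.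
by rewrite -[X in mul _ X]mulw1 reflK //; exact: Wt_one.
Qed.

Lemma refl_conj i j k w y : inWt w -> inWt y -> i != j ->
  mul w (mul (refl i j k) y) =
  mul (refl (w.2 i) (w.2 j) (k + w.1 (w.2 i) - w.1 (w.2 j))) (mul w y).
Proof.
move=> hw hy ij; apply: pt_inj => l.
rewrite pt_refl ?(inj_eq perm_inj) ?ev_mul //; last exact: Wt_mul.
rewrite pt_mul pt_refl // -[in coroot (w.2 i) _ l](permKV w.2 l) coroot_perm //.
  by rewrite pt_mul; ring.
by case: hw.
Qed.

Lemma refl_conjr i j k w : inWt w -> i != j ->
  mul w (refl i j k) =
  mul (refl (w.2 i) (w.2 j) (k + w.1 (w.2 i) - w.1 (w.2 j))) w.
Proof.
move=> hw ij; have := refl_conj k hw (@Wt_one m) ij.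
by rewrite !mulw1.
Qed.

(** Squared distance, scaled by [n ^ 2], from the base point to its image under [w]: an induction
    measure that every [step] increases. *)
Definition normsq w : int := \sum_i (pt w i - (i : nat)%:Z) ^+ 2.

(** The factors 2 and 4 are the squared norms of the coroot; the sign of the change tells whether
    the hyperplane separates the base point from its image. *)
Lemma normsq_refl i j k w : inWt w -> i != j ->
  normsq (mul (refl i j k) w) =
  normsq w + (if j == rev_ord i then 2 else 4) * ev i j k (one n) * ev i j k w.
Proof.
move=> hw ij; rewrite /normsq.
pose e := ev i j k w.
have -> : \sum_l (pt (mul (refl i j k) w) l - (l : nat)%:Z) ^+ 2 =
  \sum_l ((pt w l - (l : nat)%:Z) ^+ 2
  + (- (2 * e * (pt w l - (l : nat)%:Z)) + e ^+ 2 * coroot i j l) * (coroot i j l)%:~R).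
  by apply: eq_bigr => l _; rewrite pt_refl // intz -/e; ring.
rewrite big_split sum_coroot /=; congr (_ + _).
have ji : rev_ord j != rev_ord i by rewrite rev_ord_eq eq_sym.
have d := pt_dual i j hw.
rewrite coroot_l // coroot_r // !coroot_rev // coroot_l // coroot_r // ev_one !rev_ordE.
case: (_ == _); rewrite /e /ev; first by ring.
have -> : pt w (rev_ord j) = pt w i + pt w (rev_ord i) - pt w j by lia.
rewrite /e /ev; ring.
Qed.

(* [y] is a reflection of [x] and the hyperplane separates the base alcove [A]
   from [yA], hence not from [xA]. *)
Definition step x y := exists i j k,
  [/\ i != j, y = mul (refl i j k) x, ev i j k (one n) < 0 & 0 < ev i j k y].

Lemma step_intro i j k x : inWt x -> i != j ->
  ev i j k (one n) * ev i j k x > 0 -> step x (mul (refl i j k) x).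
Proof.
move=> hx ij; have [neg|pos|->] := ltgtP (ev i j k (one n)) 0; last by rewrite mul0r.
  rewrite nmulr_rgt0 // => h; exists i, j, k; split=> //.
  by rewrite ev_refl // oppr_gt0.
rewrite pmulr_rgt0 // => h; exists j, i, (- k); split; rewrite ?refl_opp //.
- by rewrite eq_sym.
- by rewrite ev_opp oppr_lt0.
by rewrite ev_opp ev_refl // opprK.
Qed.

Lemma step_Wt x y : inWt x -> step x y -> inWt y.
Proof. by move=> hx [i [j [k [ij -> _ _]]]]; exact/Wt_mul/hx/Wt_refl. Qed.

Lemma step_normsq x y : inWt x -> step x y -> normsq x < normsq y.
Proof.
move=> hx [i [j [k [ij e n1 n2]]]]; rewrite e ev_refl // in n2 *.
rewrite normsq_refl // ltrDl -mulrA; apply: mulr_gt0; first by case: ifP.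
by rewrite nmulr_rgt0 // -oppr_gt0.
Qed.

Lemma normsq_ge0 x : 0 <= normsq x.
Proof. by apply: sumr_ge0 => i _; exact: sqr_ge0. Qed.

Lemma normsq_ind (P : elt n -> Prop) :
  (forall y, inWt y -> (forall x, inWt x -> normsq x < normsq y -> P x) -> P y) ->
  forall y, inWt y -> P y.
Proof.
move=> h y hy; have [N] := ubnP `|normsq y|%N.
elim: N y hy => // N IH y hy lt; apply: h => // x hx lt'; apply: IH => //.
by have := normsq_ge0 x; have := normsq_ge0 y; lia.
Qed.

(* the Bruhat order, extended from [W_a] to [W~] *)
Inductive ble : elt n -> elt n -> Prop :=
| ble_refl x : ble x x
| ble_step x y z : step x y -> ble y z -> ble x z.

Lemma ble_trans x y z : ble x y -> ble y z -> ble x z.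
Proof. by elim=> // a b c hab _ IH /IH; exact: ble_step. Qed.

Lemma step_ble x y : step x y -> ble x y.
Proof. by move=> h; apply: ble_step h (ble_refl y). Qed.

(* The root [x_i - x_j - k] takes the value [1/n] at the base point exactly for
   the simple affine roots, up to the duality [(i, j) <-> (j^*, i^* )]. *)
Definition simple t := exists i j k,
  [/\ i != j, ev i j k (one n) = 1 & t = refl i j k].

Lemma simple_Wt t : simple t -> inWt t.
Proof. by move=> [i [j [k [ij _ ->]]]]; exact: Wt_refl. Qed.

Lemma simpleK t w : inWt w -> simple t -> mul t (mul t w) = w.
Proof. by move=> hw [i [j [k [ij _ ->]]]]; exact: reflK. Qed.

Lemma simple_inv t : simple t -> inv t = t.
Proof. by move=> [i [j [k [ij _ ->]]]]; exact: inv_refl. Qed.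

(** * Simple reflections and the lifting property *)

Lemma coroot_cases i j l : i != j ->
  [\/ coroot i j l = 1 /\ (l = i \/ l = rev_ord j),
      coroot i j l = -1 /\ (l = j \/ l = rev_ord i) | coroot i j l = 0].
Proof.
move=> ij.
have [->|li] := eqVneq l i; first by constructor 1; rewrite coroot_l //; auto.
have [->|lj] := eqVneq l j; first by constructor 2; rewrite coroot_r //; auto.
rewrite /coroot (negbTE li) (negbTE lj); case: ifP => _; first by constructor 3.
have [->|lj'] := eqVneq l (rev_ord j).
  by constructor 1; rewrite rev_ord_eq eq_sym (negbTE ij); auto.
by have [->|li'] := eqVneq l (rev_ord i); [constructor 2; auto|constructor 3].
Qed.

(** Only the wall of [t] separates [A] from [tA]. Applying [t] lowers an integral value by at most
    2, so a sign change from positive to negative goes from 1 to -1; this forces the coroot values 1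
    at [a] and -1 at [b], and then [(a, b, k)] is the root of [t] or its dual. *)
Lemma simple_flip t a b k : simple t -> a != b ->
  ev a b k (one n) * ev a b k t < 0 -> refl a b k = t.
Proof.
move=> [i [j [c [ij s1 ->]]]].
wlog pos : a b k / 0 < ev a b k (one n).
  move=> wl ab; have [neg|pos|->] := ltgtP (ev a b k (one n)) 0.
  - move=> h; rewrite -refl_opp //; apply: wl; rewrite ?ev_opp ?oppr_gt0 ?mulrNN //.
    by rewrite eq_sym.
  - exact: wl.
  by rewrite mul0r ltxx.
move=> ab; rewrite pmulr_rlt0 //.
have o := @Wt_one m.
have h1 := @Wt_one m.
have same a' b' c' : ev a' b k (one n) = 1 -> ev a' b' c' (one n) = 1 ->
    b = b' /\ k = c'.
  move=> e1 e2.
  have e : b = b'.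
    apply: (@pt_modn _ (one n) _ _ (c' - k)).
    by move: e1 e2; rewrite /ev mulrBr; lia.
  split=> //; move: e1 e2; rewrite -e /ev => e1 e2.
  have : n%:Z * (k - c') = 0 by rewrite mulrBr; lia.
  by have hb := ltn_ord b; move/eqP; rewrite mulf_eq0; lia.
have n1 := ev_neq0 k (refl i j c) ab.
move: (pos) n1; rewrite -(mulw1 (refl i j c)) /ev !pt_refl // s1 !mul1r !pt_one => pos' n1 h.
have [[ca ai] A1] : (coroot i j a = 1 /\ (a = i \/ a = rev_ord j)) /\ ev a b k (one n) = 1.
  rewrite ev_one; case: (coroot_cases a ij) (coroot_cases b ij) => [[ca ?]|[ca _]|ca] [[cb _]|[cb _]|cb];
    try (exfalso; lia).
  by split; [split|lia].
rewrite mulw1 -(ev_dual i j c h1) in s1 *; rewrite -(refl_dual c ij).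
case: ai => e; subst a.
  by rewrite ev_dual // in s1; case: (same _ _ _ A1 s1) => -> ->; rewrite refl_dual.
by case: (same _ _ _ A1 s1) => -> ->.
Qed.

(** A step survives left multiplication by [t] unless its hyperplane separates [A] from [tA]; in
    that case [simple_flip] makes the step the multiplication by [t]. *)
Lemma step_liftl t x y : simple t -> inWt x -> step x y ->
  step (mul t x) (mul t y) \/ mul t x = y.
Proof.
move=> st hx [i [j [k [ij -> n1 n2]]]].
have ht := simple_Wt st.
have [h|h] := ltP (ev i j k t) 0.
  left; exists (t.2 i), (t.2 j), (k + t.1 (t.2 i) - t.1 (t.2 j)).
  split; first by rewrite (inj_eq perm_inj).
  - exact: refl_conj.
  - by rewrite -(mulwV t) ev_mul simple_inv.
  by rewrite ev_mul.
right; rewrite (simple_flip st ij) // nmulr_rlt0 //.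
by rewrite lt_neqAle h eq_sym ev_neq0.
Qed.

Lemma step_liftr t x y : simple t -> inWt x -> step x y ->
  step (mul x t) (mul y t) \/ mul x t = y.
Proof.
move=> st hx sxy; have hy := step_Wt hx sxy.
move: sxy => [i [j [k [ij e n1 n2]]]].
have ht := simple_Wt st; have hV := Wt_inv hy.
have [h|h] := ltP 0 (ev i j k (mul y t)).
  by left; exists i, j, k; split=> //; rewrite mulA e.
right.
have f := ev_mul (inv y) _ i j k.
have := refl_conjr k hV ij.
rewrite [refl ((inv y).2 _) _ _](simple_flip st).
- move=> e'; have : mul t (inv y) = inv x.
    by rewrite -e' e invM -{2}(inv_refl k ij) !inv_refl // -{2}(inv_refl k ij) mulwK.
  move/(congr1 (@inv m)); rewrite invM !invK simple_inv // => <-.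
  by rewrite -{2}(simple_inv st) mulwK.
- by rewrite (inj_eq perm_inj).
rewrite -(mulKw y t) -{1}(mulVw y) !f.
by rewrite pmulr_rlt0 // lt_neqAle h ev_neq0.
Qed.

Lemma ble_liftl t x y : simple t -> inWt x -> ble x y ->
  ble (mul t x) (mul t y) \/ ble (mul t x) y.
Proof.
move=> st + h; elim: h => [a _|a b c s h IH ha]; first by left; exact: ble_refl.
have [s'|->] := step_liftl st ha s; last by right.
by case: (IH (step_Wt ha s)) => h'; [left|right]; exact: ble_step s' h'.
Qed.

Lemma ble_liftl' t x y : simple t -> inWt x -> ble x y ->
  ble (mul t x) (mul t y) \/ ble x (mul t y).
Proof.
move=> st + h; elim: h => [a _|a b c s h IH ha]; first by left; exact: ble_refl.
case: (IH (step_Wt ha s)) => [h'|h']; last by right; exact: ble_step s h'.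
have [s'|e] := step_liftl st ha s; first by left; exact: ble_step s' h'.
by right; rewrite -e simpleK // in h'.
Qed.

Lemma ble_liftr t x y : simple t -> inWt x -> ble x y ->
  ble (mul x t) (mul y t) \/ ble x (mul y t).
Proof.
move=> st + h; elim: h => [a _|a b c s h IH ha]; first by left; exact: ble_refl.
case: (IH (step_Wt ha s)) => [h'|h']; last by right; exact: ble_step s h'.
have [s'|e] := step_liftr st ha s; first by left; exact: ble_step s' h'.
by right; rewrite -e -{1}(simple_inv st) mulwKV in h'.
Qed.

Lemma step_down i j k x : inWt x -> i != j ->
  ev i j k (one n) * ev i j k x < 0 -> step (mul (refl i j k) x) x.
Proof.
move=> hx ij h; rewrite -{2}(reflK k hx ij); apply: step_intro => //.
  exact/Wt_mul/hx/Wt_refl.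
by rewrite ev_refl // mulrN oppr_gt0.
Qed.

(** The window form of membership in the stabilizer of [A]; see [shift_Omega] and [Omega_shift]. *)
Definition shift u := exists c, forall i, pt u i = (i : nat)%:Z + c.

Lemma ev_shift u i j k : shift u -> ev i j k u = ev i j k (one n).
Proof. by move=> [c h]; rewrite /ev !h !pt_one; ring. Qed.

(** A strictly increasing run of [n] integers whose ends differ by less than [n] is a run of
    consecutive integers. *)
Lemma increasing_shift u :
  (forall a b, (b : nat) = a.+1 -> pt u a < pt u b) ->
  (forall a b, (a : nat) = 0%N -> (b : nat) = n.-1 -> pt u b - n%:Z < pt u a) ->
  shift u.
Proof.
move=> h1 h2.
have mono d a b : (b : nat) = (a + d)%N -> pt u a + d%:Z <= pt u b.
  elim: d b => [|d IH] b e; first by have -> : b = a; [apply/ord_inj; lia | lia].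
  have lt : (a + d < n)%N by have := ltn_ord b; lia.
  have := IH (Ordinal lt) erefl; have := h1 (Ordinal lt) b; rewrite e addnS.
  by move=> /(_ erefl); lia.
have [n0|n0] := posnP n; first by exists 0 => i; have := ltn_ord i; rewrite {2}n0.
have ltl : (n.-1 < n)%N by lia.
exists (pt u (Ordinal n0)) => i; have hi := ltn_ord i.
have e1 := mono i (Ordinal n0) i erefl.
have e2 : pt u i + (n.-1 - i)%N%:Z <= pt u (Ordinal ltl) by apply: mono => /=; lia.
by have := h2 (Ordinal n0) (Ordinal ltl) erefl erefl; lia.
Qed.

Lemma exists_descent u :
  (exists i j k, [/\ i != j, ev i j k (one n) = 1 & ev i j k u < 0]) \/ shift u.
Proof.
apply: NNPP => /not_or_and [h1 h2]; apply: h2.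
have pos i j k : i != j -> ev i j k (one n) = 1 -> 0 < ev i j k u.
  move=> ij e; rewrite ltNge; apply/negP => le; apply: h1.
  by exists i, j, k; split=> //; rewrite lt_neqAle le ev_neq0.
apply: increasing_shift => a b.
  move=> e; have ba : b != a by apply/eqP => /(congr1 val) /=; lia.
  by have := pos b a 0 ba; rewrite ev_one e /ev; lia.
move=> ea eb; have hb := ltn_ord b.
have ab : a != b by apply/eqP => /(congr1 val) /=; lia.
by have := pos a b (-1) ab; rewrite ev_one ea eb /ev; lia.
Qed.

Lemma simple_refl i j k : i != j -> ev i j k (one n) = 1 -> simple (refl i j k).
Proof. by move=> ij e; exists i, j, k. Qed.

Lemma ble_shift u x y : inWt u -> shift u -> inWt x ->
  ble x y -> ble (mul (inv u) x) (mul (inv u) y).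
Proof.
move=> hu su + h; have hV := Wt_inv hu.
elim: h => [a _|a b c s _ IH ha]; first exact: ble_refl.
apply: ble_step (IH (step_Wt ha s)).
have [i [j [k [ij -> n1 n2]]]] := s.
exists ((inv u).2 i), ((inv u).2 j), (k + (inv u).1 ((inv u).2 i) - (inv u).1 ((inv u).2 j)).
split; first by rewrite (inj_eq perm_inj).
- exact: refl_conj.
- by rewrite -(mulVw u) ev_mul ev_shift.
by rewrite ev_mul.
Qed.

(* [ble (mul u x) (mul u y)] is the Bruhat order seen from the alcove [u^-1 A];
   the hypothesis says that no hyperplane separates [A] both from [u^-1 A] and
   from [xA]. *)
Lemma ble_strip u x y : inWt u -> inWt x ->
  (forall i j k, i != j -> 0 < ev i j k (one n) -> ev i j k (inv u) < 0 ->
     0 < ev i j k x) ->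
  ble (mul u x) (mul u y) -> ble x y.
Proof.
move=> hu hx; elim/normsq_ind: hu => {}u hu IH H hxy.
have hux := Wt_mul hu hx.
have [|su] := exists_descent u; last first.
  by have := ble_shift hu su hux hxy; rewrite !mulKw.
move=> [i [j [k [ij e1 e2]]]].
have st := simple_refl ij e1; set t := refl i j k in st.
have ht := simple_Wt st; have htu := Wt_mul ht hu.
have sd : step (mul t u) u by apply: step_down => //; rewrite e1 mul1r.
apply: (IH (mul t u)) => //; first exact: step_normsq sd.
  (* A hyperplane separating [A] from the alcove of [inv (mul t u)] already separates it from that
     of [inv u]: otherwise its image under [u] would be the wall of [t], and [t] would raise [u]
     although it lowers it. *)
  move=> a b c ab p1 p2; have [h|h] := ltP (ev a b c (inv u)) 0; first exact: H.
  have f z : ev (u.2 a) (u.2 b) (c + u.1 (u.2 a) - u.1 (u.2 b)) (mul u z) = ev a b c z.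
    exact: ev_mul.
  have uab : u.2 a != u.2 b by rewrite (inj_eq perm_inj).
  have := f (one n); have := f (inv u); have := f (inv (mul t u)).
  rewrite invM (simple_inv st) mulKVw mulwV mulw1 => f1 f2 f3.
  rewrite invM (simple_inv st) in p2; rewrite -f2 in h.
  have h' : 0 < ev (u.2 a) (u.2 b) (c + u.1 (u.2 a) - u.1 (u.2 b)) (one n).
    by rewrite lt_neqAle h eq_sym ev_neq0.
  have up : step u (mul t u).
    rewrite -(simple_flip (k := c + u.1 (u.2 a) - u.1 (u.2 b)) st uab).
      by apply: step_intro => //; rewrite f3 mulr_gt0.
    by rewrite f1 pmulr_rlt0.
  by have := lt_trans (step_normsq hu up) (step_normsq htu sd); rewrite ltxx.
(* The wall of [t], pulled back by [u], separates [A] from [u^-1 A], hence not from [xA]; so [t]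
   lowers [mul u x] too, and both outcomes of the lifting property give the inequality for
   [mul t u]. *)
have sdx : step (mul t (mul u x)) (mul u x).
  apply: step_down => //; rewrite e1 mul1r.
  have f z : ev ((inv u).2 i) ((inv u).2 j) (k + (inv u).1 ((inv u).2 i) - (inv u).1 ((inv u).2 j)) (mul (inv u) z) = ev i j k z.
    exact: ev_mul.
  rewrite -f mulKw -oppr_gt0 -ev_opp; apply: H.
  - by rewrite eq_sym (inj_eq perm_inj).
  - by rewrite ev_opp oppr_gt0 -(mulVw u) f.
  by rewrite ev_opp oppr_lt0; have := f (one n); rewrite mulw1 e1 => ->.
rewrite -!mulA; case: (ble_liftl' st hux hxy) => // h.
exact: ble_step sdx h.
Qed.

End BruhatOrder.

(** * Comparison with reduced words *)

Section CoxeterPresentation.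
Variable m : nat.
Local Notation n := (m.*2).
Implicit Types (x y z w u v o t : elt n) (i j l a b : 'I_n) (k c : int).
Implicit Types (s : seq (elt n)).

(* [Defs] uses the operations of [Rdefinitions], the canonical ones are only
   convertible to them. *)
Lemma actRE w (x : 'I_n -> R) l : actR w x l = (w.1 l)%:~R + x ((w.2^-1)%g l).
Proof. by []. Qed.

Lemma actR_refl i j k (x : 'I_n -> R) l : inV x -> i != j ->
  actR (refl i j k) x l = x l - (x i - x j - k%:~R) * (coroot i j l)%:~R.
Proof.
move=> hx ij; rewrite actRE /= ffunE rpermV reflection_formula // intrM; ring.
Qed.

Lemma refl_isRefl i j k : i != j -> isRefl i j k (refl i j k).
Proof.
move=> ij; split; first exact: Wt_refl.
split; first by rewrite -{2}(inv_refl k ij) mulwV.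
split; last first.
  move=> x hx e l; have {}e : x i - x j = k%:~R := e.
  by rewrite actR_refl // e subrr mul0r subr0.
move=> e; have := pt_refl k i (@Wt_one m) ij; rewrite e mulw1 coroot_l // mulr1.
by have := ev_neq0 k (one n) ij; lia.
Qed.

(** The point [x0], half of [k] times the coroot, lies on the hyperplane. Comparing it with
    [x0 + v], for antisymmetric integral [v] with [v i = v j], isolates the linear part, and
    suitable [v] determine [p]. The identity remains possible here because translations are
    invisible to this test. *)
Lemma isRefl_perm i j k t : i != j -> isRefl i j k t ->
  (t.2^-1)%g = 1%g \/ (t.2^-1)%g = rperm i j.
Proof.
move=> ij [[_ ht] [_ [_ fix_t]]]; set p := (t.2^-1)%g.
have hp : inSstar p by exact: Sstar_inv.
pose x0 l : R := k%:~R / 2%:R * (coroot i j l)%:~R.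
have x0_rev l : x0 l + x0 (rev_ord l) = 0.
  by rewrite /x0 coroot_rev // mulrNz mulrN subrr.
have x0_ij : x0 i - x0 j = k%:~R.
  by rewrite /x0 coroot_l // coroot_r //; field.
have stable (v : 'I_n -> int) l : (forall a, v a + v (rev_ord a) = 0) ->
    v i = v j -> v (p l) = v l.
  move=> hv vij.
  have e0 : actR t x0 l = x0 l.
    by apply: fix_t => // a b; exact: etrans (x0_rev a) (esym (x0_rev b)).
  pose x1 a : R := x0 a + (v a)%:~R.
  have x1_rev a : x1 a + x1 (rev_ord a) = 0.
    by rewrite /x1 addrACA x0_rev -intrD hv addr0.
  have x1_ij : x1 i - x1 j = k%:~R by rewrite /x1 vij opprD addrACA subrr addr0.
  have e1 : actR t x1 l = x1 l.
    by apply: fix_t => // a b; exact: etrans (x1_rev a) (esym (x1_rev b)).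
  move: e1; rewrite actRE -/p /x1 addrA => e1; rewrite actRE -/p in e0.
  by rewrite e0 in e1; apply: (@intr_inj R); exact: addrI e1.
pose B := [set i; j; rev_ord i; rev_ord j].
have fixB l : l \notin B -> p l = l.
  rewrite !inE !negb_or => /andP [/andP [/andP [li lj] li'] lj'].
  have := stable (fun a => (a == l)%:R - (rev_ord a == l)%:R) l.
  rewrite eqxx /= (negbTE (rev_ord_neq l)) => h.
  have : (p l == l)%:R - (rev_ord (p l) == l)%:R = 1 :> int.
    rewrite h //; first by move=> a; rewrite rev_ordK; ring.
    by rewrite ![_ == l]eq_sym (negbTE li) (negbTE lj) (negbTE li') (negbTE lj').
  by case: (p l =P l) => // _; case: (_ == _).
have imB l : l \in B -> p l \in B.
  move=> lB; apply/negPn/negP => h; have := fixB _ h => /perm_inj e.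
  by rewrite e lB in h.
have prev l : p (rev_ord l) = rev_ord (p l) by exact: hp.
have [ji|ji] := eqVneq j (rev_ord i).
  have Bij : B =i [set i; j].
    by move=> l; rewrite !inE ji rev_ordK; case: (l == i); case: (l == rev_ord i).
  have := imB i; rewrite !Bij !inE eqxx => /(_ isT) /orP [] /eqP pi.
    left; apply/permP => l; rewrite perm1.
    have [|/fixB //] := boolP (l \in B); rewrite Bij !inE => /orP [] /eqP -> //.
    by rewrite ji prev pi.
  right; apply/permP => l; rewrite /rperm ji eqxx -ji.
  have [|lB] := boolP (l \in B).
    rewrite Bij !inE => /orP [] /eqP ->; first by rewrite tpermL.
    by rewrite tpermR {1}ji prev pi ji rev_ordK.
  rewrite fixB //; move: lB; rewrite Bij !inE negb_or => /andP [h1 h2].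
  by rewrite tpermD // eq_sym.
have n1 : i != rev_ord j by rewrite -rev_ord_eqC eq_sym.
(* This vector takes the value 1 exactly at [i] and [j], so [p] preserves the pair. *)
pose v (a : 'I_n) : int := (a == i)%:R + (a == j)%:R - (rev_ord a == i)%:R - (rev_ord a == j)%:R.
have vi : v i = 1.
  by rewrite /v eqxx (negbTE ij) (negbTE (rev_ord_neq i)) eq_sym (negbTE ji).
have vj : v j = 1.
  by rewrite /v eqxx eq_sym (negbTE ij) (negbTE (rev_ord_neq j)) rev_ord_eqC (negbTE ji).
have stv l : v (p l) = v l.
  by apply: stable; rewrite ?vi ?vj // => a; rewrite /v rev_ordK; ring.
have v1 l : v l = 1 -> l = i \/ l = j.
  rewrite /v; case: (l =P i) => [|_]; first by left.
  by case: (l =P j) => [|_]; [right|case: (_ == _); case: (_ == _)].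
have := v1 (p i); rewrite stv => /(_ vi) hi; have := v1 (p j); rewrite stv => /(_ vj) hj.
have ext (q : {perm 'I_n}) : q i = p i -> q j = p j -> inSstar q -> (forall l, l \notin B -> q l = l) -> p = q.
  move=> qi qj hq qB; apply/permP => l.
  have [|/[dup] /fixB -> /qB -> //] := boolP (l \in B).
  by rewrite !inE -!orbA => /or4P [] /eqP ->; rewrite ?prev ?hq ?qi ?qj.
case: hi => pi; case: hj => pj.
- by move: ij; rewrite -(inj_eq (@perm_inj _ p)) pi pj eqxx.
- by left; apply: ext; rewrite ?perm1 // => l; rewrite !perm1.
- right; apply: ext.
  + by rewrite pi /rperm (negbTE ji) permM tpermL tpermD // ?rev_ord_neq // eq_sym.
  + by rewrite pj /rperm (negbTE ji) permM tpermR tpermD // ?rev_ord_neq // eq_sym.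
  + exact: (Wt_refl 0 ij).2.
  move=> l; rewrite !inE !negb_or => /andP [/andP [/andP [li lj] li'] lj'].
  by rewrite /rperm (negbTE ji) permM !tpermD // eq_sym.
by move: ij; rewrite -(inj_eq (@perm_inj _ p)) pi pj eqxx.
Qed.

Lemma isRefl_eq i j k t : i != j -> isRefl i j k t -> t = refl i j k.
Proof.
move=> ij h; case: (isRefl_perm ij h) => e.
  (* With trivial linear part, [t] is an involutive translation, hence the identity, which [isRefl]
     excludes. *)
  case: h => [_ [tt [t1 _]]]; case: t1; move: tt e.
  case: t => [f s]; rewrite /= => -[e1 _] es.
  have -> : s = 1%g by rewrite -(invgK s) es invg1.
  congr pair; apply/ffunP=> l; move/ffunP: e1 => /(_ l).
  by rewrite !ffunE /= es perm1; lia.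
case: h => [_ [_ [_ fix_t]]].
apply: (etrans (surjective_pairing t)); congr pair; last first.
  by apply: invg_inj; rewrite e rpermV.
apply/ffunP => l; rewrite ffunE.
pose x0 l : R := k%:~R / 2%:R * (coroot i j l)%:~R.
have x0_rev a : x0 a + x0 (rev_ord a) = 0.
  by rewrite /x0 coroot_rev // mulrNz mulrN subrr.
have x0_ij : x0 i - x0 j = k%:~R.
  by rewrite /x0 coroot_l // coroot_r //; field.
have inVx0 : inV x0 by move=> a b; exact: etrans (x0_rev a) (esym (x0_rev b)).
have := fix_t x0 inVx0 x0_ij l; rewrite actRE e reflection_formula // x0_ij => h.
apply: (@intr_inj R); rewrite intrM; apply/eqP; rewrite -subr_eq0; apply/eqP.
by rewrite -[RHS](subrr (x0 l)) -{1}h; ring.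
Qed.

Lemma simpleReflP t : (0 < m)%N -> simpleRefl t <-> simple t.
Proof.
move=> m0; split.
  move=> [a [b [[ea [eb h]]|[eb [lb h]]]]].
    have ab : a != b by apply/eqP => /(congr1 val) /=; lia.
    exists a, b, (-1); split; rewrite ?ev_one //; last exact: isRefl_eq.
    by rewrite ea eb; lia.
  have ab : a != b by apply/eqP => /(congr1 val) /=; lia.
  exists b, a, 0; split; first by rewrite eq_sym.
    by rewrite ev_one; lia.
  by rewrite -oppr0 refl_opp //; exact: isRefl_eq.
move=> [i [j [k [ij e ->]]]].
have hi := ltn_ord i; have hj := ltn_ord j; rewrite ev_one in e.
have : k = 0 \/ k = -1 by nia.
case=> ek; rewrite ek in e *.
  have ji : j != i by rewrite eq_sym.
  have [le|lt] := leqP i m.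
    by exists j, i; right; split; [lia|split=> //; rewrite -refl_opp // oppr0; exact: refl_isRefl].
  (* [simpleRefl] lists the walls of the left half only; a wall of the right half is named by its
     dual root. *)
  exists (rev_ord i), (rev_ord j); right; split; first by rewrite /=; lia.
  split; first by rewrite /=; lia.
  rewrite -refl_dual // -oppr0 refl_opp ?rev_ord_eq ?oppr0 //.
  by apply: refl_isRefl; rewrite rev_ord_eq.
exists i, j; left; split; [lia|split; first lia].
exact: refl_isRefl.
Qed.

(** The relation defining [V] mirrors the inequalities of the left half to the right half. *)
Lemma inA_E (x : 'I_n -> R) : (0 < m)%N ->
  inA x <-> inV x /\ forall a b, (a < b)%N -> x a < x b /\ x b < x a + 1.
Proof.
move=> m0; split.
  move=> [hV [h0 h1]]; split=> //.
  have V a b : x a + x (rev_ord a) = x b + x (rev_ord b) := hV a b.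
  have lt1 a b : (b : nat) = a.+1 -> x a < x b.
    move=> e; have hb := ltn_ord b; have [le|lt] := leqP b m.
      by apply/RltP; exact: h1.
    have /RltP : Rlt (x (rev_ord b)) (x (rev_ord a)) by apply: h1 => /=; lia.
    by have := V a b; lra.
  have mono d a b : (b : nat) = (a + d)%N -> x a <= x b.
    elim: d b => [|d IH] b e; first by have -> : b = a; [apply/ord_inj; lia | ].
    have lt : (a + d < n)%N by have := ltn_ord b; lia.
    apply: le_trans (IH (Ordinal lt) erefl) _.
    by apply/ltW/lt1; rewrite e addnS.
  move=> a b ab; have hb := ltn_ord b; split.
    have ha : (a.+1 < n)%N by lia.
    apply: lt_le_trans (lt1 a (Ordinal ha) erefl) _.
    by apply: (mono (b - a.+1)%N) => /=; lia.
  have n0 : (0 < n)%N by lia. have nl : (n.-1 < n)%N by lia.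
  have l0 := h0 (Ordinal n0) (Ordinal nl) erefl erefl.
  have lb : x b <= x (Ordinal nl) by apply: (mono (n.-1 - b)%N) => /=; lia.
  have la : x (Ordinal n0) <= x a by apply: (mono a).
  have {}l0 : x (Ordinal nl) - 1 < x (Ordinal n0) by exact/RltP.
  by lra.
move=> [hV h]; split=> //; split.
  move=> a b ea eb; have [|_ lt] := h a b; first by rewrite ea eb; lia.
  by apply/RltP; rewrite -[X in X < _]/(x b - 1) ltrBlDr.
by move=> a b e _; apply/RltP; case: (h a b); rewrite ?e.
Qed.

Lemma inV_actR w (x : 'I_n -> R) : inWt w -> inV (actR w x) <-> inV x.
Proof.
move=> [h1 h2].
have V (y : 'I_n -> R) a b : inV y -> y a + y (rev_ord a) = y b + y (rev_ord b).
  by move=> h; exact: (h a b).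
have e a : actR w x a + actR w x (rev_ord a) =
   (w.1 a + w.1 (rev_ord a))%:~R + (x ((w.2^-1)%g a) + x (rev_ord ((w.2^-1)%g a))).
  by rewrite !actRE (Sstar_inv h2) intrD addrACA.
split=> h a b.
  have := V _ (w.2 a) (w.2 b) h; rewrite !e (h1 _ (w.2 b)) => /addrI.
  by rewrite !permK.
by apply: (etrans (e a)); rewrite (h1 a b) (V _ _ ((w.2^-1)%g b) h) -e.
Qed.

Lemma shift_Omega o : (0 < m)%N -> inWt o -> shift o -> inOmega o.
Proof.
move=> m0 ho [c sh]; split=> // x hx; rewrite !inA_E //.
have hV := inV_actR x ho.
have key p q : let a := o.2 p in let b := o.2 q in
   actR o x a = (o.1 a)%:~R + x p /\
   (n%:Z * (o.1 b - o.1 a) = (b : nat)%:Z - (a : nat)%:Z + (p : nat)%:Z - (q : nat)%:Z).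
  split; first by rewrite actRE permK.
  by have := sh (o.2 p); have := sh (o.2 q); rewrite /pt !permK mulrBr; lia.
(* For [a < b] the translation parts differ by 0 or 1, according as the order of the two positions
   is kept or reversed: [o] rotates the cyclic chain [x_0 < ... < x_(n-1) < x_0 + 1]. *)
have dich N (d r : int) : N * d = r -> - N < r -> r < 2 * N -> d = 0 \/ d = 1 by nia.
split=> [[_ h]|[_ h]]; split; rewrite ?hV // => a b ab.
  pose p := (o.2^-1)%g a; pose q := (o.2^-1)%g b.
  have [ea eb] : a = o.2 p /\ b = o.2 q by rewrite !permKV.
  have [] := key p q; have [] := key q p; rewrite -ea -eb => -> _ -> e.
  have ha := ltn_ord a; have hb := ltn_ord b; have hp := ltn_ord p; have hq := ltn_ord q.
  have pq : (p : nat) <> q by move=> /ord_inj e'; rewrite ea eb e' in ab; lia.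
  have [||d|d] := dich _ _ _ e; try lia.
    have lt : (p < q)%N by move: e; rewrite d mulr0; lia.
    have -> : o.1 b = o.1 a by lia.
    by have [] := h _ _ lt; lra.
  have lt : (q < p)%N by move: e; rewrite d mulr1; lia.
  have -> : o.1 b = o.1 a + 1 by lia.
  by rewrite intrD; have [] := h _ _ lt; lra.
have [ea e] := key a b; have [eb _] := key b a.
have ha := ltn_ord a; have hb := ltn_ord b.
have hA := ltn_ord (o.2 a); have hB := ltn_ord (o.2 b).
have [lt|lt|/ord_inj/perm_inj e'] := ltngtP (o.2 a) (o.2 b); last by rewrite e' in ab; lia.
  have d : o.1 (o.2 b) - o.1 (o.2 a) = 0.
    by apply: small_multiple_eq0 (esym e) _ _; lia.
  have d' : o.1 (o.2 b) = o.1 (o.2 a) by lia.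
  by have [] := h _ _ lt; rewrite ea eb d'; lra.
have d : o.1 (o.2 b) - o.1 (o.2 a) = -1.
  by have [||d|d] := dich n%:Z (o.1 (o.2 a) - o.1 (o.2 b)) _ (erefl _); rewrite ?mulrBr in e *; lia.
have d' : o.1 (o.2 a) = o.1 (o.2 b) + 1 by lia.
by have [] := h _ _ lt; rewrite ea eb d' intrD; lra.
Qed.

Lemma Omega_shift o : (0 < m)%N -> inOmega o -> shift o.
Proof.
move=> m0 [ho hA].
have n0 : (0 : R) < n%:R by rewrite ltr0n; lia.
(* The base point lies in [A], and its image under [o], multiplied by [n], is the window of [o]. *)
pose x (l : 'I_n) : R := (l : nat)%:~R / n%:R.
have xV : inV x.
  have e a : x a + x (rev_ord a) = (n%:Z - 1)%:~R / n%:R.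
    by rewrite /x rev_ordE -mulrDl -intrD; congr (_%:~R / _); ring.
  by move=> a b; exact: etrans (e a) (esym (e b)).
have xA : inA x.
  apply/inA_E => //; split=> // a b ab; rewrite /x; split.
    by rewrite ltr_pM2r ?invr_gt0 // ltr_int.
  rewrite ltr_pdivrMr // mulrDl mul1r divfK ?gt_eqF //.
  by have := ltn_ord b; rewrite -[X in _ + X]/(n%:Z%:~R) -intrD ltr_int; lia.
have oE l : actR o x l = (pt o l)%:~R / n%:R.
  rewrite actRE /x /pt intrD intrM mulrDl mulrAC -[n%:Z%:~R]/(n%:R) divff ?mul1r //.
  by rewrite gt_eqF.
have /inA_E [] := (hA x xV).1 xA => // _ h.
apply: increasing_shift => a b.
  move=> e; have [|+ _] := h a b; first by lia.
  by rewrite !oE ltr_pM2r ?invr_gt0 // ltr_int.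
move=> ea eb; have [|_ +] := h a b; first by have := ltn_ord b; lia.
rewrite !oE ltr_pdivrMr // mulrDl mul1r divfK ?gt_eqF //.
by rewrite -[X in _ + X]/(n%:Z%:~R) -intrD ltr_int; lia.
Qed.

(** * Words, strong exchange and the subword property *)

Definition simple_seq s := forall t, t \in s -> simple t.

Lemma simple_cons t s : simple_seq (t :: s) <-> simple t /\ simple_seq s.
Proof.
split=> [h|[h1 h2] u]; last by rewrite inE => /orP [/eqP -> //|/h2].
by split=> [|u us]; apply: h; rewrite inE ?eqxx ?us ?orbT.
Qed.

Lemma simple_subseq s s' : subseq s' s -> simple_seq s -> simple_seq s'.
Proof. by move=> /mem_subseq h hs t /h /hs. Qed.

Lemma prodw_Wt s : simple_seq s -> inWt (prodw s).
Proof.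
elim: s => [_|t s IH /simple_cons [ht hs]]; first exact: Wt_one.
exact: Wt_mul (simple_Wt ht) (IH hs).
Qed.

(** Follow the gallery of the word: if the hyperplane separates [A] from [tA] it is the wall of [t],
    and this letter is deleted; otherwise conjugate by [t] and delete in the tail. The element [o]
    has length zero and never affects signs. *)
Lemma strong_exchange s o i j k : simple_seq s -> inWt o -> shift o -> i != j ->
  ev i j k (one n) * ev i j k (mul (prodw s) o) < 0 ->
  exists s', [/\ subseq s' s, (size s' < size s)%N &
    mul (refl i j k) (mul (prodw s) o) = mul (prodw s') o].
Proof.
move=> + ho so; elim: s i j k => [|t s IH] i j k /=.
  by rewrite mul1w ev_shift // => _ _; rewrite -expr2 ltNge sqr_ge0.
move=> /simple_cons [st hs] ij; rewrite -mulA => lt.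
have ht := simple_Wt st; have hp := Wt_mul (prodw_Wt hs) ho.
have [neg|pos] := ltP (ev i j k (one n) * ev i j k t) 0.
  exists s; split=> //; first exact: subseq_cons.
  by rewrite (simple_flip st ij neg) simpleK.
set y := mul (prodw s) o in lt IH hp *.
have tt : mul t t = one n by rewrite -{2}(simple_inv st) mulwV.
have pos' : 0 < ev i j k (one n) * ev i j k t.
  by rewrite lt_neqAle pos eq_sym mulf_neq0 // ev_neq0.
pose i' := t.2 i; pose j' := t.2 j; pose k' := k + t.1 i' - t.1 j'.
have f z : ev i' j' k' (mul t z) = ev i j k z by exact: ev_mul.
have [|| s' [ss lts e]] := IH i' j' k' hs; rewrite ?(inj_eq perm_inj) //.
  have := f t; have := f (mul t y); rewrite simpleK // tt => -> ->.
  by move: lt pos'; nra.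
exists (t :: s'); split=> //=; first by rewrite eqxx.
rewrite -mulA -e -[in RHS](simpleK hp st) -(refl_conj k ht) //; last exact/Wt_mul.
rewrite simpleK -?mulA //.
exact: Wt_mul (Wt_refl k ij) (Wt_mul ht hp).
Qed.

Lemma ble_subseq s o x : simple_seq s -> inWt o -> shift o -> inWt x ->
  ble x (mul (prodw s) o) -> exists2 s', subseq s' s & x = mul (prodw s') o.
Proof.
move=> hs ho so hx; move e : (mul _ _) => y h; elim: h hx e => [z _ <-|a b c st _ IH ha e].
  by exists s.
have [s1 ss1 e1] := IH (step_Wt ha st) e; move: st => [i [j [k [ij eb n1 n2]]]].
have hb : inWt b by rewrite eb; exact/Wt_mul/ha/Wt_refl.
have [|s2 [ss2 _ e2]] := strong_exchange (i := i) (j := j) (k := k)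
  (simple_subseq ss1 hs) ho so ij.
  by rewrite -e1 nmulr_rlt0.
exists s2; first exact: subseq_trans ss2 ss1.
by rewrite -e2 -e1 eb reflK.
Qed.

Definition word w (l : nat) := exists s o,
  [/\ simple_seq s, size s = l, inWt o /\ shift o & w = mul (prodw s) o].

Lemma exists_word w : inWt w -> exists l : nat, word w l.
Proof.
elim/normsq_ind=> {}w hw IH; have [|sw] := exists_descent w; last first.
  by exists 0%N, [::], w; split; rewrite //= mul1w.
move=> [i [j [k [ij e1 e2]]]].
have st := simple_refl ij e1; have ht := Wt_refl k ij; have htw := Wt_mul ht hw.
have [|l [s [o [hs _ ho e]]]] := IH (mul (refl i j k) w) htw.
  by apply: step_normsq htw _; apply: step_down; rewrite // e1 mul1r.
exists (size s).+1, (refl i j k :: s), o; split=> //; first exact/simple_cons.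
by rewrite /= -mulA -e reflK.
Qed.

(** Reducedness makes each letter an ascent over the product to its right, since otherwise strong
    exchange would shorten the word; the lifting property then handles a kept letter. *)
Lemma reduced_ble s s' : (0 < m)%N -> reducedWord s -> subseq s' s ->
  ble (prodw s') (prodw s).
Proof.
move=> m0 [hw hmin].
have {}hw : simple_seq s by move=> t /hw /(simpleReflP _ m0).
have {}hmin r : simple_seq r -> prodw r = prodw s -> (size s <= size r)%N.
  by move=> hr; apply: hmin => t /hr /(simpleReflP _ m0).
elim: s s' hw hmin => [|t s IH] s'.
  by rewrite subseq0 => _ _ /eqP ->; exact: ble_refl.
move=> /simple_cons [st hs] hmin.
have hp := prodw_Wt hs.
have {}IH r : subseq r s -> ble (prodw r) (prodw s).
  move=> rs; apply: IH => // q hq e.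
  by have := hmin (t :: q); rewrite /= e ltnS; apply=> //; exact/simple_cons.
have up : step (prodw s) (mul t (prodw s)).
  have [i [j [k [ij e et]]]] := st; rewrite et; apply: step_intro => //.
  rewrite lt_neqAle eq_sym mulf_neq0 ?ev_neq0 //= leNgt; apply/negP => lt.
  have s1 : shift (one n) by exists 0 => a; rewrite pt_one addr0.
  rewrite -(mulw1 (prodw s)) in lt.
  have [r [rs lts er]] := strong_exchange hs (@Wt_one m) s1 ij lt.
  have := hmin r (simple_subseq rs hs); rewrite !mulw1 -et in er.
  by rewrite -er => /(_ erefl) /=; lia.
case: s' => [_|a r /=].
  exact: ble_trans (IH [::] (sub0seq s)) (step_ble up).
case: eqP => [-> rs|_ rs]; last exact: ble_trans (IH _ rs) (step_ble up).
have hr := prodw_Wt (simple_subseq rs hs).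
case: (ble_liftl st hr (IH _ rs)) => // h; exact: ble_trans h (step_ble up).
Qed.

Lemma ble_mul_shift o x y : inWt x -> inWt o -> shift o -> ble x y -> ble (mul x o) (mul y o).
Proof.
move=> + ho so h; elim: h => [a _|a b c st _ IH ha]; first exact: ble_refl.
have hb := step_Wt ha st; apply: ble_step (IH hb).
have [i [j [k [ij e n1 n2]]]] := st; exists i, j, k; split=> //.
  by rewrite mulA -e.
have f z := ev_mul (inv b) z i j k.
by rewrite -f mulKw ev_shift // -(mulVw b) f.
Qed.

Lemma bruhat_ble x y : (0 < m)%N -> bruhat x y -> ble x y.
Proof.
move=> m0 [x' [y' [o [_ _ ho [-> ->] [s [b [hs [<- <-]]]]]]]].
have hw : simple_seq s by move=> t /hs.1 /(simpleReflP _ m0).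
have ss : subseq (mask b s) s by exact: mask_subseq.
apply: ble_mul_shift (reduced_ble m0 hs ss); first exact/prodw_Wt/(simple_subseq ss).
  by case: ho.
exact: Omega_shift.
Qed.

Lemma simple_affRefl t : (0 < m)%N -> simple t -> affRefl t.
Proof.
move=> m0 [i [j [k [ij e ->]]]]; have [lt|lt|/ord_inj e'] := ltngtP i j.
- by exists i, j, k; split=> //; exact: refl_isRefl.
- exists j, i, (- k); split=> //; rewrite -[X in refl X]/i -refl_opp //.
  by apply: refl_isRefl; rewrite eq_sym.
by rewrite e' eqxx in ij.
Qed.

Lemma simple_inWa s : (0 < m)%N -> simple_seq s -> inWa (prodw s).
Proof. by move=> m0 hs; exists s; split=> // t /hs /(simple_affRefl m0). Qed.
End CoxeterPresentation.

(** * Facets and minimal coset representatives *)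

Section Facets.
Variable m : nat.
Hypothesis m_gt0 : (0 < m)%N.
Local Notation n := (m.*2).
Implicit Types (x y z w u v o t : elt n) (j l a b : 'I_n) (k c q i : int).

(* [act w (omega n i)] is obtained by applying [fl ^~ i] to the window of [w]. *)
Definition fl (z i : int) : int := ((z - i) %/ n%:Z)%Z.

Lemma fl_ge (q z i : int) : (q <= fl z i) = (n%:Z * q + i <= z).
Proof. by rewrite /fl lez_divRL ?lerBrDr 1?mulrC //; lia. Qed.

Lemma fl_lt (q z i : int) : (fl z i < q) = (z < n%:Z * q + i).
Proof. by rewrite ltNge fl_ge -ltNge. Qed.

Lemma fl_shiftl (z i q : int) : fl (z + n%:Z * q) i = fl z i + q.
Proof. by rewrite /fl addrAC addrC mulrC divzMDl 1?addrC //; lia. Qed.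

Lemma fl_shiftr (z i q : int) : fl z (i + n%:Z * q) = fl z i - q.
Proof. by rewrite -fl_shiftl /fl; congr divz; ring. Qed.

Lemma fl_mono (z z' i : int) : z <= z' -> fl z i <= fl z' i.
Proof. by move=> h; rewrite fl_ge (le_trans _ h) // -fl_ge. Qed.

Lemma fl_eq (z i q : int) : n%:Z * q + i <= z -> z < n%:Z * (q + 1) + i -> fl z i = q.
Proof. by rewrite -fl_ge -fl_lt; lia. Qed.

Lemma fl_ord l i : fl (l : nat)%:Z i = omega n i l.
Proof.
have n0 : n%:Z != 0 by lia.
rewrite /omega ffunE; set q := divz i n; set r := modz i n.
have e : i = q * n%:Z + r by exact: divz_eq.
have r0 : 0 <= r by exact: modz_ge0.
have rn : r < n%:Z by rewrite -[X in _ < X]gtz0_abs ?ltz_mod //; lia.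
have hl := ltn_ord l.
by apply: fl_eq; case: ifP => h; lia.
Qed.

Lemma act_omega w i l : act w (omega n i) l = fl (pt w l) i.
Proof. by rewrite ffunE -fl_ord /pt [X in _ = fl X _]addrC fl_shiftl addrC. Qed.

Variable I : {set 'I_m.+1}.
Hypothesis I_neq0 : I != set0.
Local Notation J := (inPMI I).

Lemma stabGL_P v : stabGL I v <-> forall i, J i -> forall l, fl (pt v l) i = fl (l : nat)%:Z i.
Proof.
split=> h i hi; first by move=> l; rewrite -act_omega h // fl_ord.
by apply/ffunP=> l; rewrite act_omega h // fl_ord.
Qed.

Lemma J_ex : exists i, J i.
Proof. by have /set0Pn [k hk] := I_neq0; exists (k : nat)%:Z; exists k => //; left. Qed.

Lemma J_shift i q : J i -> J (i + n%:Z * q).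
Proof. by move=> [k hk h]; exists k; rewrite // addrC mulrC !modzMDl. Qed.

Lemma J_opp i : J i -> J (- i).
Proof.
have neg (a b : int) : modz a n = modz b n -> modz (- a) n = modz (- b) n.
  by move=> e; rewrite -[LHS]modzNm e modzNm.
by move=> [k hk [h|h]]; exists k => //; [right|left]; rewrite (neg _ _ h) ?opprK.
Qed.

Lemma WI_one : inWI I (one n).
Proof. by split; [exact: Wt_one | move=> i _; exact: act_one]. Qed.

Lemma WI_mul u v : inWI I u -> inWI I v -> inWI I (mul u v).
Proof.
move=> [h1 h2] [h3 h4]; split; first exact: Wt_mul.
by move=> i hi; rewrite act_mul h4 // h2.
Qed.

Lemma WI_inv v : inWI I v -> inWI I (inv v).
Proof.
move=> [h1 h2]; split; first exact: Wt_inv.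
by move=> i hi; rewrite -{1}(h2 i hi) -act_mul mulVw act_one.
Qed.

(** * Cosets of [W_I] and their minimal representatives *)

Lemma coset_refl w : inCoset I w w.
Proof. by exists (one n); [exact: WI_one | rewrite mulw1]. Qed.

Lemma coset_mul w x v : inCoset I w x -> inWI I v -> inCoset I w (mul x v).
Proof. by move=> [u hu ->] hv; exists (mul u v); [exact: WI_mul|rewrite mulA]. Qed.

Lemma coset_rel w x y : inCoset I w x -> inCoset I w y -> exists2 v, inWI I v & y = mul x v.
Proof.
move=> [u hu ->] [v hv ->]; exists (mul (inv u) v); last by rewrite mulA mulwK.
exact: WI_mul (WI_inv hu) hv.
Qed.

Lemma coset_Wt w x : inWt w -> inCoset I w x -> inWt x.
Proof. by move=> hw [v [hv _] ->]; exact: Wt_mul. Qed.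

(** One vertex suffices to detect a nonzero shift. This makes the identity the only element of
    length zero in [W_I]. *)
Lemma shift_stab v : shift v -> stabGL I v -> v = one n.
Proof.
move=> [c sh] /stabGL_P st; apply: pt_inj => l; rewrite sh pt_one.
suff -> : c = 0 by rewrite addr0.
have [i hi] := J_ex.
pose r := modz i n; pose q := divz i n.
have e : i = q * n%:Z + r by exact: divz_eq.
have r0 : 0 <= r by apply: modz_ge0; lia.
have rn : r < n%:Z by rewrite -[X in _ < X]gtz0_abs ?ltz_mod //; lia.
(* [fl ^~ i] jumps on reaching the index [r]: a negative shift pushes [r] back across the jump, a
   positive one pushes the index just before it forward. *)
have [lt|lt|//] := ltgtP c 0.
  have h : (`|r|%N < n)%N by lia.
  have := st i hi (Ordinal h); rewrite sh /= => e2.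
  have e1 : fl `|r|%N%:Z i = - q by apply: fl_eq; lia.
  by have := fl_lt (- q) (`|r|%N%:Z + c) i; rewrite e2 e1; lia.
have [r1|r1] := eqVneq r 0.
  have h : (n.-1 < n)%N by lia.
  have := st i hi (Ordinal h); rewrite sh /= => e2.
  have e1 : fl n.-1%:Z i = - q by apply: fl_eq; lia.
  by have := fl_ge (- q + 1) (n.-1%:Z + c) i; rewrite e2 e1; lia.
have h : (`|r - 1|%N < n)%N by lia.
have := st i hi (Ordinal h); rewrite sh /= => e2.
have e1 : fl `|r - 1|%N%:Z i = - q - 1 by apply: fl_eq; lia.
by have := fl_ge (- q) (`|r - 1|%N%:Z + c) i; rewrite e2 e1; lia.
Qed.

(* If [v] fixes the facet and inverts the simple root [x_j - x_l - k], then the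
   hyperplane of that root contains the facet. *)
Lemma descent_stab j l k v : j != l -> ev j l k (one n) = 1 -> ev j l k v < 0 ->
  inWI I v -> inWI I (refl j l k).
Proof.
move=> jl e1 ev0 [hv /stabGL_P st]; split; first exact: Wt_refl.
have h1 := @Wt_one m.
have same a b : ev a b k (one n) = 1 -> ev a b k v < 0 -> forall i, J i ->
    fl (a : nat)%:Z i = fl ((a : nat)%:Z - 1) i /\ fl (b : nat)%:Z i = fl ((b : nat)%:Z + 1) i.
  move=> e1' lt i hi; rewrite ev_one in e1'.
  have sa := st i hi a; have sb := st i hi b.
  have eb : (b : nat)%:Z = (a : nat)%:Z - 1 + n%:Z * (- k) by lia.
  have eb1 : (b : nat)%:Z + 1 = (a : nat)%:Z + n%:Z * (- k) by lia.
  suff e : fl (a : nat)%:Z i = fl ((a : nat)%:Z - 1) i by rewrite eb1 eb !fl_shiftl e.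
  apply/eqP; rewrite eq_le (@fl_mono (_ - 1)) ?andbT; last by lia.
  rewrite leNgt; apply/negP => h.
  have ge : n%:Z * fl (a : nat)%:Z i + i <= pt v a by rewrite -fl_ge sa.
  have lt' : pt v b < n%:Z * (fl (a : nat)%:Z i - k) + i.
    by rewrite -fl_lt sb eb fl_shiftl; lia.
  by move: lt; rewrite /ev; move: lt'; rewrite mulrBr; lia.
have e1' : ev (rev_ord l) (rev_ord j) k (one n) = 1 by rewrite ev_dual.
have ev0' : ev (rev_ord l) (rev_ord j) k v < 0 by rewrite ev_dual.
apply/stabGL_P => i hi a; rewrite -[refl _ _ _]mulw1 pt_refl // e1 mul1r pt_one.
have [s1 s2] := same _ _ e1 ev0 i hi; have [s3 s4] := same _ _ e1' ev0' i hi.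
case: (coroot_cases a jl) => [[-> [] ->]|[-> [] ->]|->] //; rewrite ?subr0 ?opprK //.
Qed.

(** This is the induction principle for [W_I]: a nontrivial element has a right descent inside
    [W_I], so [W_I] is generated by the simple reflections it contains. *)
Lemma facet_descent v : inWI I v -> v = one n \/ exists j l k,
  [/\ j != l, ev j l k (one n) = 1, ev j l k (inv v) < 0 & inWI I (refl j l k)].
Proof.
move=> hv; have hV := WI_inv hv.
have [[j [l [k [jl e1 lt]]]]|sv] := exists_descent (inv v); [right|left].
  by exists j, l, k; split=> //; exact: descent_stab lt hV.
by rewrite -(invK v) (shift_stab sv hV.2) -[LHS]mul1w mulwV.
Qed.

Lemma facet_step j l k v : j != l -> ev j l k (one n) = 1 -> ev j l k (inv v) < 0 ->
  inWt v -> step (mul v (refl j l k)) v.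
Proof.
move=> jl e1 lt hv; rewrite refl_conjr //; apply: step_down => //.
  by rewrite (inj_eq perm_inj).
have f z := ev_mul v z j l k.
have := f (one n); have := f (inv v); rewrite mulwV mulw1 => -> ->.
by rewrite e1 mulr1.
Qed.

(** Remove right descents of [v] one at a time; each time the lifting property either leaves [x]
    alone or multiplies it by a reflection of [W_I]. *)
Lemma coset_descent x y0 v : inWt x -> inWt y0 -> inWI I v -> ble x (mul y0 v) ->
  exists2 x1, inCoset I x x1 & ble x1 y0.
Proof.
move=> hx hy0 hv; have hv1 := hv.1; elim/normsq_ind: hv1 x hx hv => {}v hv IH x hx hvI hxy.
have [e|[j [l [k [jl e1 lt hr]]]]] := facet_descent hvI.
  by exists x; [exact: coset_refl|rewrite e mulw1 in hxy].
have sd := facet_step jl e1 lt hv.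
have st := simple_refl jl e1; have hvr := WI_mul hvI hr.
have {}IH z : inWt z -> ble z (mul y0 (mul v (refl j l k))) ->
    exists2 x1, inCoset I z x1 & ble x1 y0.
  by move=> hz hb; apply: (IH (mul v (refl j l k))) => //; [exact: hvr.1|exact: step_normsq hvr.1 sd].
case: (ble_liftr st hx hxy); rewrite -mulA => h; last exact: IH h.
have [x1 h1 h2] := IH _ (Wt_mul hx hr.1) h; exists x1 => //.
by case: h1 => u hu ->; exists (mul (refl j l k) u); [exact: WI_mul|rewrite mulA].
Qed.

(** Minimality in geometric form: no hyperplane whose reflection lies in [W_I] separates [A] from
    [x^-1 A]. *)
Definition facet_min x := forall j l k, j != l -> inWI I (refl j l k) ->
  0 < ev j l k (one n) * ev j l k (inv x).

Lemma facet_min_ble x v : inWt x -> facet_min x -> inWI I v -> ble x (mul x v).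
Proof.
move=> hx hmin hv; have hv1 := hv.1; elim/normsq_ind: hv1 hv => {}v hv IH hvI.
have [->|[j [l [k [jl e1 lt hr]]]]] := facet_descent hvI.
  by rewrite mulw1; exact: ble_refl.
have sd := facet_step jl e1 lt hv.
have hvr := WI_mul hvI hr.
have := IH _ hvr.1 (step_normsq hvr.1 sd) hvr; rewrite mulA => h.
apply: ble_trans h (step_ble _).
(* The root transported by [v] still has its reflection in [W_I], so minimality of [x] applies to it
   and shows that the descent of [v] is one of [mul x v]. *)
pose j' := v.2 j; pose l' := v.2 l; pose k' := k + v.1 j' - v.1 l'.
have jl' : j' != l' by rewrite (inj_eq perm_inj).
have hr' : inWI I (refl j' l' k').
  by rewrite -(mulwK v (refl _ _ _)) -refl_conjr //; exact: WI_mul hvr (WI_inv hvI).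
apply: facet_step => //; last exact: Wt_mul.
have := hmin _ _ _ jl' hr'; rewrite invM.
have f z : ev j' l' k' (mul v z) = ev j l k z by exact: ev_mul.
have := f (inv v); have := f (mul (inv v) (inv x)).
by rewrite mulwV mulKVw => -> ->; move: lt; nra.
Qed.

(** Take a shortest word in the whole coset. A violation of [facet_min] would shorten it within the
    coset by strong exchange. *)
Lemma exists_minRep w : inWt w -> exists x (l : nat),
  [/\ minRep I w x, facet_min x, word x l & forall r : nat, word x r -> (l <= r)%N].
Proof.
move=> hw.
have [l [[x hx wx] hmin]] : exists l : nat, (exists2 x, inCoset I w x & word x l) /\
   forall r : nat, (exists2 x, inCoset I w x & word x r) -> (l <= r)%N.
  apply: (@nat_least (fun l : nat => exists2 x, inCoset I w x & word x l)); have [l h] := exists_word hw.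
  by exists l, w; [exact: coset_refl|].
have hx1 := coset_Wt hw hx.
exists x, l; split=> //; last by move=> l' h; apply: hmin; exists x.
- split=> //; exists l; split.
    have [s [o [hs hl [ho so] e]]] := wx.
    exists (prodw s), o; split=> //; first exact: simple_inWa.
      exact: shift_Omega.
    exists s; split=> //; split; first by move=> t /hs /(simpleReflP _ m_gt0).
    move=> s' hs' e'; rewrite hl; apply: hmin; exists x => //; exists s', o; split=> //.
      by move=> t /hs' /(simpleReflP _ m_gt0).
    by rewrite e e'.
  move=> y l' hy [x' [o [_ ho e [s [hs [es hl]]]]]]; apply: hmin; exists y => //.
  exists s, o; split=> //; last by rewrite es.
    by move=> t /hs.1 /(simpleReflP _ m_gt0).
  by split; [case: ho|exact: Omega_shift].
move=> a b k ab hr.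
rewrite lt_neqAle eq_sym mulf_neq0 ?ev_neq0 //= leNgt; apply/negP => lt.
have [s [o [hs hl [ho so] e]]] := wx.
pose a' := x.2 a; pose b' := x.2 b; pose k' := k + x.1 a' - x.1 b'.
have f z : ev a' b' k' (mul x z) = ev a b k z by exact: ev_mul.
have ab' : a' != b' by rewrite (inj_eq perm_inj).
have [|s' [ss lts e']] := strong_exchange (k := k') hs ho so ab'.
  have := f (one n); have := f (inv x); rewrite -e mulwV mulw1 => -> ->.
  by rewrite mulrC.
have : (l <= size s')%N.
  apply: hmin; exists (mul x (refl a b k)); first exact: coset_mul.
  exists s', o; split=> //; first exact: simple_subseq hs.
  by rewrite -e' -e -refl_conjr.
by lia.
Qed.

(** Arbitrary representatives may be compared: descend from [y] to the minimal [y0], then replace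
    the lower element by the minimal [x0]. *)
Lemma bruhatI_intro w u x y : inWt w -> inWt u -> inCoset I w x -> inCoset I u y ->
  ble x y -> bruhatI I w u.
Proof.
move=> hw hu hx hy hxy.
have [x0 [_ [mx fx _ _]]] := exists_minRep hw; have [y0 [l [my _ wy lmin]]] := exists_minRep hu.
have hx0 := coset_Wt hw mx.1; have hy0 := coset_Wt hu my.1.
have [v hv ev] := coset_rel my.1 hy; rewrite ev in hxy.
have [x1 c1 b1] := coset_descent (coset_Wt hw hx) hy0 hv hxy.
have [v1 hv1 e1] : exists2 v, inWI I v & x1 = mul x0 v.
  have [v2 hv2 e2] := coset_rel mx.1 hx; have [v3 hv3 e3] := c1.
  by exists (mul v2 v3); [exact: WI_mul|rewrite e3 e2 mulA].
have le : ble x0 y0.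
  by apply: ble_trans b1; rewrite e1; exact: facet_min_ble.
exists x0, y0; split=> //.
have [s [o [hs hl [ho so] e]]] := wy; rewrite e in le.
have [s' ss' es'] := ble_subseq hs ho so hx0 le.
exists (prodw s'), (prodw s), o; split=> //.
- exact/simple_inWa/(simple_subseq ss').
- exact: simple_inWa.
- exact: shift_Omega.
have /subseqP [b _ eb] := ss'; exists s, b; split; last by rewrite -eb.
split; first by move=> t /hs /(simpleReflP _ m_gt0).
move=> s2 hs2 e2; rewrite hl; apply: lmin; exists s2, o; split=> //.
  by move=> t /hs2 /(simpleReflP _ m_gt0).
by rewrite e e2.
Qed.
End Facets.

(** * Admissible cosets are permissible *)

(** The new vector is a convex combination of [v] and its transposition at [a] and [b], with weight
    [t / (v a - v b)] on the latter. *)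
Lemma conv_step n (mu v : vec n) (a b : 'I_n) (t : int) :
  inConv mu v -> a != b -> 0 <= t -> t <= v a - v b ->
  inConv mu [ffun l => v l - t * ((l == a)%:R - (l == b)%:R)].
Proof.
move=> [c [c0 [c1 cv]]] ab t0 tle.
have [e|d0] := eqVneq (v a - v b) 0.
  have -> : t = 0 by lia.
  by exists c; split=> //; split=> // j; rewrite ffunE mul0r subr0.
have dpos : (0 : R) < (v a - v b)%:~R by rewrite ltr0z; lia.
pose th : R := t%:~R / (v a - v b)%:~R.
have th0 : 0 <= th by apply: divr_ge0; [rewrite ler0z|exact: ltW].
have th1 : th <= 1 by rewrite ler_pdivrMr // mul1r ler_int.
have thE : th * (v a - v b)%:~R = t%:~R by rewrite divfK // gt_eqF.
clearbody th.
pose tau := tperm a b.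
exists (fun s => (1 - th) * c s + th * c (s * tau)%g); split.
  by move=> s; apply: addr_ge0; apply: mulr_ge0; rewrite // subr_ge0.
split.
  rewrite big_split -!mulr_sumr c1 /=.
  have -> : \sum_(s : {perm 'I_n}) c (s * tau)%g = 1.
    by rewrite -c1 [RHS](reindex_inj (mulIg tau)).
  by rewrite !mulr1 subrK.
move=> l; rewrite ffunE.
under eq_bigr do rewrite mulrDl -!mulrA.
rewrite big_split -!mulr_sumr /= -cv.
have -> : \sum_(s : {perm 'I_n}) c (s * tau)%g * (permv s mu l)%:~R = (v (tau l))%:~R.
  rewrite cv [RHS](reindex_inj (mulIg tau)); apply: eq_bigr => s _; congr (_ * _%:~R).
  by rewrite !ffunE invMg permM tpermV tpermK.
rewrite /tau; case: tpermP => [->|->|/eqP/negbTE -> /eqP/negbTE ->].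
- rewrite eqxx (negbTE ab) [X in t * X](_ : _ = 1) // mulr1 intrB -thE intrB; ring.
- rewrite eqxx eq_sym (negbTE ab) [X in t * X](_ : _ = -1) // mulrN1 opprK intrD -thE intrB; ring.
by rewrite subrr mulr0 subr0; ring.
Qed.

(** Subtract the [l]-th largest value [t] everywhere. The sum of positive parts over all indices is
    invariant under [h], is attained by the sorted prefix and bounds every other choice of [l]
    entries. *)
Lemma prefix_sum_max n (nu : 'I_n -> int) (h : {perm 'I_n}) (l : nat) :
  (forall a b : 'I_n, (a <= b)%N -> nu b <= nu a) -> (l <= n)%N ->
  \sum_(c < n | (c < l)%N) nu (h c) <= \sum_(c < n | (c < l)%N) nu c.
Proof.
move=> mono ln; have [->|l0] := posnP l; first by rewrite !big_pred0.
have ll : (l.-1 < n)%N by lia.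
pose t := nu (Ordinal ll); pose pp z : int := Num.max (z - t) 0.
rewrite -subr_ge0 -sumrB.
have -> : \sum_(c < n | (c < l)%N) (nu c - nu (h c)) =
  \sum_(c < n | (c < l)%N) (nu c - t) - \sum_(c < n | (c < l)%N) (nu (h c) - t).
  by rewrite -sumrB; apply: eq_bigr => c _; ring.
rewrite subr_ge0.
have -> : \sum_(c < n | (c < l)%N) (nu c - t) = \sum_c pp (nu c).
  rewrite [RHS](bigID (fun c : 'I_n => (c < l)%N)) /= [X in _ + X]big1 ?addr0.
    apply: eq_bigr => c cl; rewrite /pp max_l // subr_ge0; apply: mono => /=; lia.
  by move=> c lc; rewrite /pp max_r // subr_le0; apply: mono => /=; lia.
rewrite [leRHS](reindex_inj (@perm_inj _ h)) [leRHS](bigID (fun c : 'I_n => (c < l)%N)) /=.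
rewrite -[leLHS]addr0; apply: lerD.
  by apply: ler_sum => c _; rewrite /pp le_max lexx.
by apply: sumr_ge0 => c _; rewrite /pp le_max lexx orbT.
Qed.

Lemma conv_prefix n (mu v : vec n) (rho tau : {perm 'I_n}) (l : nat) : (l <= n)%N ->
  (forall a b : 'I_n, (a <= b)%N -> mu (rho b) <= mu (rho a)) -> inConv mu v ->
  \sum_(c < n | (c < l)%N) v (tau c) <= \sum_(c < n | (c < l)%N) mu (rho c).
Proof.
move=> ln mono [f [f0 [f1 fv]]].
rewrite -(ler_int R).
set z := \sum_(c < n | _) mu _.
have -> : z%:~R = \sum_s f s * z%:~R by rewrite -mulr_suml f1 mul1r.
rewrite rmorph_sum /=.
under eq_bigr do rewrite fv.
rewrite exchange_big /=; apply: ler_sum => s _.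
rewrite -mulr_sumr; apply: ler_wpM2l => //.
rewrite -rmorph_sum ler_int.
apply: le_trans (prefix_sum_max (nu := fun c => mu (rho c)) (tau * s^-1 * rho^-1)%g mono ln).
by rewrite le_eqVlt; apply/orP; left; apply/eqP/eq_bigr => c _; rewrite !permM permKV ffunE.
Qed.

Lemma conv_total n (mu v : vec n) : inConv mu v -> \sum_c v c = \sum_c mu c.
Proof.
move=> [f [f0 [f1 fv]]]; apply: (@intr_inj R).
set z := \sum_c mu c; have -> : z%:~R = \sum_s f s * z%:~R by rewrite -mulr_suml f1 mul1r.
rewrite rmorph_sum /=.
under eq_bigr do rewrite fv.
rewrite exchange_big /=; apply: eq_bigr => s _; rewrite -mulr_sumr; congr (_ * _).
rewrite -rmorph_sum; congr (_%:~R).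
rewrite [RHS](reindex_inj (@perm_inj _ (s^-1)%g)); apply: eq_bigr => c _.
by rewrite ffunE.
Qed.

Section AdmissibleIsPermissible.
Variables (m : nat) (I : {set 'I_m.+1}).
Hypotheses (m_gt0 : (0 < m)%N) (I_neq0 : I != set0).
Local Notation n := (m.*2).
Local Notation fl := (@fl m).
Implicit Types (x y w : elt n) (mu : vec n).

Lemma conv_down i x y mu : inWt x -> step x y ->
  inConv mu [ffun l => act y (omega n i) l - omega n i l] ->
  inConv mu [ffun l => act x (omega n i) l - omega n i l].
Proof.
move=> hx sxy hc; have hy := step_Wt hx sxy.
have [a [b [k [ab ey n1 n2]]]] := sxy.
have ex : x = mul (refl a b k) y by rewrite ey reflK.
pose e := ev a b k y.
have px l : pt x l = pt y l - e * coroot a b l by rewrite ex pt_refl.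
pose D z := [ffun l => act z (omega n i) l - omega n i l] : vec n.
have DE z l : D z l = fl (pt z l) i - fl (l : nat)%:Z i.
  by rewrite ffunE act_omega // fl_ord.
(* [t p q] is what position [p] loses to [q]. Monotonicity of [fl] for [y] gives [0 <= t p q], and
   for the base alcove [t p q <= D y p - D y q], as [conv_step] requires. *)
pose t p q := fl (pt y p) i - fl (pt y q) i - k.
have bound p q : 0 < ev p q k y -> ev p q k (one n) < 0 -> 0 <= t p q <= D y p - D y q.
  rewrite ev_one /ev => h1 h2; rewrite !DE.
  have := @fl_mono _ m_gt0 (pt y q + n%:Z * k) (pt y p) i.
  have := @fl_mono _ m_gt0 (p : nat)%:Z ((q : nat)%:Z + n%:Z * k) i.
  by rewrite !fl_shiftl // /t; lia.
have [t0 t1] := andP (bound a b n2 n1).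
have hc1 := conv_step hc ab t0 t1.
have drop p q : pt x p = pt y q + n%:Z * k -> D x p = D y p - t p q.
  by move=> h; rewrite !DE h fl_shiftl // /t; lia.
have rise p q : pt x p = pt y q - n%:Z * k -> D x p = D y p + t q p.
  by move=> h; rewrite !DE h -mulrN fl_shiftl // /t; lia.
have fixd p : coroot a b p = 0 -> D x p = D y p.
  by move=> h; rewrite !DE px h mulr0 subr0.
have Da : D x a = D y a - t a b.
  by apply: drop; rewrite px coroot_l // /e /ev; ring.
have Db : D x b = D y b + t a b.
  by apply: rise; rewrite px coroot_r // /e /ev; ring.
have [ba|ba] := eqVneq b (rev_ord a).
  suff -> : [ffun l => act x (omega n i) l - omega n i l] =
     [ffun l => D y l - t a b * ((l == a)%:R - (l == b)%:R)] by [].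
  apply/ffunP=> l; rewrite [RHS]ffunE -[LHS]/(D x l).
  have [->|la] := eqVneq l a; first by rewrite Da (negbTE ab) /=; ring.
  have [->|lb] := eqVneq l b; first by rewrite Db /=; ring.
  rewrite fixd; first by rewrite /=; ring.
  by rewrite /coroot (negbTE la) (negbTE lb) ba eqxx.
have ra := rev_ord_neq a; have rb := rev_ord_neq b.
have abr : a != rev_ord b by rewrite -rev_ord_eqC eq_sym.
have rab : rev_ord b != rev_ord a by rewrite rev_ord_eq eq_sym.
have n1' : ev (rev_ord b) (rev_ord a) k (one n) < 0 by rewrite ev_dual //; exact: Wt_one.
have n2' : 0 < ev (rev_ord b) (rev_ord a) k y by rewrite ev_dual.
have [t0' t1'] := andP (bound _ _ n2' n1').
have Db' : D x (rev_ord b) = D y (rev_ord b) - t (rev_ord b) (rev_ord a).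
  apply: drop; rewrite px coroot_rev // coroot_r // /e -(ev_dual a b k hy) /ev; ring.
have Da' : D x (rev_ord a) = D y (rev_ord a) + t (rev_ord b) (rev_ord a).
  apply: rise; rewrite px coroot_rev // coroot_l // /e -(ev_dual a b k hy) /ev; ring.
set v1 := finfun _ in hc1.
have v1E l : v1 l = D y l - t a b * ((l == a)%:R - (l == b)%:R).
  by rewrite ffunE -/(D y l).
have v1b : v1 (rev_ord b) = D y (rev_ord b).
  by rewrite v1E [_ == a]eq_sym (negbTE abr) (negbTE rb) /=; ring.
have v1a : v1 (rev_ord a) = D y (rev_ord a).
  by rewrite v1E (negbTE ra) [_ == b]eq_sym (negbTE ba) /=; ring.
have := conv_step hc1 rab t0'; rewrite v1a v1b => /(_ t1').
suff -> : [ffun l => act x (omega n i) l - omega n i l] =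
   [ffun l => v1 l - t (rev_ord b) (rev_ord a) * ((l == rev_ord b)%:R - (l == rev_ord a)%:R)] by [].
apply/ffunP=> l; rewrite [RHS]ffunE -[LHS]/(D x l) v1E.
have [->|la] := eqVneq l a.
  by rewrite Da (negbTE ab) (negbTE abr) [a == rev_ord a]eq_sym (negbTE ra) /=; ring.
have [->|lb] := eqVneq l b.
  by rewrite Db (negbTE ba) [b == rev_ord b]eq_sym (negbTE rb) /=; ring.
have [->|lb'] := eqVneq l (rev_ord b); first by rewrite Db' (negbTE rab) /=; ring.
have [->|la'] := eqVneq l (rev_ord a); first by rewrite Da' /=; ring.
rewrite fixd; first by rewrite /=; ring.
by rewrite /coroot (negbTE la) (negbTE lb) (negbTE la') (negbTE lb') (negbTE ba).
Qed.

Lemma conv_ble i x y mu : inWt x -> ble x y ->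
  inConv mu [ffun l => act y (omega n i) l - omega n i l] ->
  inConv mu [ffun l => act x (omega n i) l - omega n i l].
Proof.
move=> + h; elim: h => [z _ //|a b c st _ IH ha hc].
apply: (conv_down ha st); apply: IH hc; exact: step_Wt st.
Qed.

Lemma conv_orbit mu (s : {perm 'I_n}) : inConv mu (permv s mu).
Proof.
exists (fun s' => (s' == s)%:R); split; first by move=> s'; exact: ler0n.
split; first by rewrite (bigD1 s) //= eqxx big1 ?addr0 // => s' /negbTE ->.
move=> j; rewrite (bigD1 s) //= eqxx mul1r big1 ?addr0 // => s' /negbTE ->.
by rewrite mul0r.
Qed.

Lemma Adm_Perm mu w : inWt w -> Adm I mu w -> PermGL I mu w.
Proof.
move=> hw [s hs [x [y [mx my b]]]] i hi.
have hx : inWt x by exact: coset_Wt hw mx.1.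
have := conv_ble (i := i) (mu := mu) hx (bruhat_ble m_gt0 b).
have [[v [_ hv] ->] [u [_ hu] ->]] := (mx.1, my.1).
rewrite !act_mul hv // hu //; apply.
suff -> : [ffun l => act (transl (permv s mu)) (omega n i) l - omega n i l] = permv s mu.
  exact: conv_orbit.
by apply/ffunP => l; rewrite !ffunE invg1 perm1 addrK.
Qed.
End AdmissibleIsPermissible.

(** * Raising a facet in the semi-infinite order *)

Section SemiInfiniteOrder.
Variable m : nat.
Hypothesis m_gt0 : (0 < m)%N.
Local Notation n := (m.*2).
Local Notation fl := (@fl m).
Implicit Types (x y w : elt n) (a b c : 'I_n) (i k q K : int) (l : nat).

Lemma fl_anti (z i i' : int) : i <= i' -> fl z i' <= fl z i.
Proof. by move=> h; rewrite fl_ge // (le_trans _ (_ : n%:Z * fl z i' + i' <= z)) ?lerD2l // -fl_ge. Qed.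

Lemma fl_rev (z z' K i : int) : z + z' = n%:Z * K + n%:Z - 1 -> fl z' i = K - fl z (- i).
Proof.
move=> e; have h1 := fl_ge m_gt0 (fl z (- i)) z (- i).
have h2 := fl_lt m_gt0 (fl z (- i) + 1) z (- i).
by apply: fl_eq => //; move: h1 h2; rewrite lexx ltrDl ltr01 !mulrDr ?mulrN; lia.
Qed.

(** [K] is the similitude of the translation part of [w]; the term [n - 1] is the sum of two dual
    indices. *)
Definition has_sim w K := forall c, pt w c + pt w (rev_ord c) = n%:Z * K + n%:Z - 1.

Lemma exists_sim w : inWt w -> exists K, has_sim w K.
Proof.
move=> hw; have n0 : (0 < n)%N by lia.
by exists (w.1 (Ordinal n0) + w.1 (rev_ord (Ordinal n0))) => c; exact: pt_rev.
Qed.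

Lemma sim_refl w K a b k : inWt w -> a != b -> has_sim w K -> has_sim (mul (refl a b k) w) K.
Proof. by move=> hw ab h c; rewrite !pt_refl // coroot_rev // -(h c); ring. Qed.

(** The pairing of the vertex [act w (omega n i)] with the [l]-th fundamental weight of [GL_n];
    comparing these for all [l] is the dominance order. *)
Definition psum w l i : int := \sum_(c < n | (c < l)%N) fl (pt w c) i.

Lemma psum_succ w a i : psum w a.+1 i = psum w a i + fl (pt w a) i.
Proof.
rewrite /psum (bigD1 a) //= addrC; congr (_ + _); apply: eq_bigl => c.
by rewrite ltnS ltn_neqAle andbC.
Qed.

Lemma eq_psum x y l i : (forall c, (c < l)%N -> fl (pt x c) i = fl (pt y c) i) ->
  psum x l i = psum y l i.
Proof. by move=> h; apply: eq_bigr. Qed.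

Lemma psum_total w K i : has_sim w K ->
  psum w n i = m%:Z * K + \sum_c omega n i c.
Proof.
move=> hK.
have e1 : psum w n i = \sum_c w.1 c + \sum_c omega n i c.
  rewrite [\sum_c omega _ _ c](reindex_inj (@perm_inj _ (w.2^-1)%g)) -big_split /psum /=.
  apply: eq_big => c; first by rewrite ltn_ord.
  by rewrite -act_omega // ffunE.
have e2 : \sum_c w.1 c + \sum_c w.1 c = n%:Z * K.
  rewrite [X in _ + X](reindex_inj rev_ord_inj) -big_split /=.
  have -> : \sum_c (w.1 c + w.1 (rev_ord c)) = \sum_(c < n) K.
    apply: eq_bigr => c _.
    have h1 := hK c; have p := ltn_ord ((w.2^-1)%g c); have q := ltn_ord ((w.2^-1)%g (rev_ord c)).
    have e : (w.2^-1%g c : nat)%:Z + (w.2^-1%g (rev_ord c) : nat)%:Z - n%:Z + 1 = n%:Z * (K - w.1 c - w.1 (rev_ord c)).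
      by move: h1; rewrite /pt !mulrBr; lia.
    have := @small_multiple_eq0 _ _ _ e; lia.
  by rewrite sumr_const card_ord -mulr_natl natz.
by rewrite e1; nia.
Qed.

Lemma psum_rev w K l i : has_sim w K -> (l <= n)%N ->
  psum w (n - l) i = psum w n i - l%:Z * K + psum w l (- i).
Proof.
move=> hK ln; apply/eqP; rewrite addrAC eq_sym subr_eq eq_sym.
have -> : psum w n i = psum w (n - l) i + \sum_(c < n | (c < l)%N) fl (pt w (rev_ord c)) i.
  rewrite /psum (bigID (fun c : 'I_n => (c < n - l)%N)) /=; congr (_ + _).
    by apply: eq_bigl => c; rewrite ltn_ord.
  rewrite (reindex_inj rev_ord_inj) /=; apply: eq_bigl => c.
  by have := ltn_ord c; rewrite -leqNgt; lia.
rewrite -addrA -big_split /=.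
have -> : \sum_(c < n | (c < l)%N) (fl (pt w (rev_ord c)) i + fl (pt w c) (- i)) = \sum_(c < n | (c < l)%N) K.
  by apply: eq_bigr => c _; rewrite (fl_rev _ (hK c)) subrK.
by rewrite -(big_ord_widen n (fun=> K) ln) sumr_const card_ord -mulr_natl natz addrC.
Qed.

Lemma psum_shift w l i q : (l <= n)%N -> psum w l (i + n%:Z * q) = psum w l i - l%:Z * q.
Proof.
move=> ln; rewrite /psum; under eq_bigr do rewrite fl_shiftr //.
by rewrite sumrB -(big_ord_widen n (fun=> q) ln) sumr_const card_ord -mulr_natl natz.
Qed.

Definition gain x a b k i := fl (pt x b + n%:Z * k) i - fl (pt x a) i.

(** [gain] is what position [a] receives at the vertex [i]. By [fl_rev] the mirror exchange at [i]
    is governed by the gain at [- i]. *)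
Lemma psum_refl x K a b k l i : inWt x -> has_sim x K -> a != b ->
  psum (mul (refl a b k) x) l i = psum x l i
  + ((a < l)%N%:R - (b < l)%N%:R) * gain x a b k i
  + (if b == rev_ord a then 0 else
       ((rev_ord b < l)%N%:R - (rev_ord a < l)%N%:R) * gain x a b k (- i)).
Proof.
move=> hx hK ab.
set g := gain x a b k i; set g' := gain x a b k (- i).
have -> : ((a < l)%N%:R - (b < l)%N%:R) * g =
    \sum_(c < n | (c < l)%N) ((c == a)%:R - (c == b)%:R) * g.
  by under [RHS]eq_bigr do rewrite mulrBl; rewrite sumrB !sum_delta mulrBl.
have -> : (if b == rev_ord a then 0 else ((rev_ord b < l)%N%:R - (rev_ord a < l)%N%:R) * g') =
    \sum_(c < n | (c < l)%N) (if b == rev_ord a then 0 else ((c == rev_ord b)%:R - (c == rev_ord a)%:R) * g').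
  case: eqP => _; first by rewrite big1.
  by under [RHS]eq_bigr do rewrite mulrBl; rewrite sumrB !sum_delta mulrBl.
rewrite /psum -!big_split /=; apply: eq_bigr => c _; rewrite pt_refl //.
set e := ev a b k x.
have ea : pt x a - e = pt x b + n%:Z * k by rewrite /e /ev; ring.
have eb : pt x b + e = pt x a + n%:Z * (- k) by rewrite /e /ev; ring.
have ga : fl (pt x a - e) i = fl (pt x a) i + g by rewrite ea /g /gain; ring.
have gb : fl (pt x b + e) i = fl (pt x b) i - g.
  by rewrite eb /g /gain !fl_shiftl //; ring.
have [->|ca] := eqVneq c a.
  rewrite coroot_l // mulr1 ga (negbTE ab).
  case: eqP => [_|h]; first by rewrite /=; ring.
  have -> : a == rev_ord b = false by rewrite -rev_ord_eqC; apply/eqP => e'; apply: h.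
  by rewrite [a == _]eq_sym (negbTE (rev_ord_neq a)) /=; ring.
have [->|cb] := eqVneq c b.
  rewrite coroot_r // mulrN1 opprK gb.
  case: eqP => [_|h]; first by rewrite /=; ring.
  by rewrite [b == rev_ord b]eq_sym (negbTE (rev_ord_neq b)) /=; ring.
rewrite /coroot (negbTE ca) (negbTE cb).
case: eqP => [_|h]; first by rewrite !mulr0 subr0 /=; ring.
have h1 := hK a; have h2 := hK b.
have [->|cb'] := eqVneq c (rev_ord b).
  rewrite rev_ord_eq eq_sym (negbTE ab) /= !subr0 add0r mulr1.
  have h3 : pt x a + n%:Z * (- k) + (pt x (rev_ord b) - e) = n%:Z * K + n%:Z - 1 by lia.
  rewrite (fl_rev _ h3) (fl_rev _ h2) /g' /gain !fl_shiftl //; ring.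
have [->|ca'] := eqVneq c (rev_ord a); last first.
  by rewrite /= [X in fl X](_ : _ = pt x c); ring.
rewrite /= [X in fl X _ = _](_ : _ = pt x (rev_ord a) + e); last by ring.
have h3 : pt x b + n%:Z * k + (pt x (rev_ord a) + e) = n%:Z * K + n%:Z - 1 by lia.
by rewrite (fl_rev _ h3) (fl_rev _ h1) /g' /gain; ring.
Qed.

Variable I : {set 'I_m.+1}.
Hypothesis I_neq0 : I != set0.
Local Notation J := (inPMI I).

Definition dom x y := forall l i, (l <= n)%N -> J i -> psum x l i <= psum y l i.

Lemma psum_dual x y K l i : has_sim x K -> has_sim y K -> (l <= n)%N ->
  psum y (n - l) i - psum x (n - l) i = psum y l (- i) - psum x l (- i).
Proof.
by move=> hx hy ln; rewrite !(@psum_rev _ K) // !(@psum_total _ K) //; ring.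
Qed.

(** Equal similitudes make the deficit of the prefix [l] at [i] equal to that of [n - l] at [- i],
    and [J] is stable under negation. *)
Lemma dom_half x y K : has_sim x K -> has_sim y K ->
  (forall l i, (l <= m)%N -> J i -> psum x l i <= psum y l i) -> dom x y.
Proof.
move=> hx hy h l i ln hi; have [lm|lm] := leqP l m; first exact: h.
have l' : (n - l <= n)%N by lia.
have := psum_dual i hx hy l'; rewrite subKn // => e.
have l2 : (n - l <= m)%N by lia.
by have := h (n - l)%N (- i) l2 (J_opp hi); lia.
Qed.

(** Elements of [J] cut the integers into blocks on which [fl ^~ i] is constant for each [i] in [J];
    [q] is where the block after that of [z] begins. *)
Lemma J_next (z : int) : exists q, [/\ J q, z < q & forall i, J i -> i < q -> i <= z].
Proof.
have [i0 hi0] := J_ex I_neq0.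
have [d [hd dmin]] : exists d : nat, J (z + 1 + d%:Z) /\ forall d' : nat, J (z + 1 + d'%:Z) -> (d <= d')%N.
  apply: (@nat_least (fun d : nat => J (z + 1 + d%:Z))).
  pose q : int := (absz (z + 1 - i0)%R)%:Z.
  exists (absz (i0 + n%:Z * q - (z + 1))%R).
  have -> : z + 1 + (absz (i0 + n%:Z * q - (z + 1))%R)%:Z = i0 + n%:Z * q by rewrite /q; nia.
  exact: J_shift.
exists (z + 1 + d%:Z); split=> // [|i hi lt]; first by lia.
rewrite leNgt; apply/negP => lt'.
have := dmin (absz (i - (z + 1))%R).
have -> : z + 1 + (absz (i - (z + 1))%R)%:Z = i by lia.
by move=> /(_ hi); lia.
Qed.

(* A tableau criterion: if the facet of [x] is dominated vertexwise by that of
   [y] without being equal to it, some reflection raises [x] and preserves the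
   domination.  With [a] the first position where they differ, [x a] is
   replaced by a value in the window from [x a] to the end of the block of
   [y a], taken from the first position [b0] that offers one.  This moves
   [b0^*] as well, so when [b0] lies in the right half and [a^*] also offers a
   value, the long root is used instead; otherwise the two changes do not
   accumulate. *)
Lemma dom_raise x y K : inWt x -> has_sim x K -> has_sim y K -> dom x y ->
  (exists c i, J i /\ fl (pt x c) i <> fl (pt y c) i) ->
  exists a b k, [/\ (a < b)%N, ev a b k x < 0 & dom (mul (refl a b k) x) y].
Proof.
move=> hx sx sy hd ex.
have [a [[i1 [hi1 ne]] same]] : exists a, (exists i, J i /\ fl (pt x a) i <> fl (pt y a) i) /\
   forall c i, (c < a)%N -> J i -> fl (pt x c) i = fl (pt y c) i.
  have [a [ha h]] := ord_least ex; exists a; split=> // c i ca hi.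
  by apply: NNPP => h'; apply: (h c ca); exists i.
have psum_a i : J i -> psum x a i = psum y a i.
  by move=> hi; apply: eq_psum => c ca; exact: same.
have le_a i : J i -> fl (pt x a) i <= fl (pt y a) i.
  by move=> hi; have := hd a.+1 i (ltn_ord a) hi; rewrite !psum_succ psum_a // lerD2l.
pose i2 := i1 + n%:Z * fl (pt y a) i1.
have hi2 : J i2 by exact: J_shift.
have ya : i2 <= pt y a by rewrite /i2 addrC -fl_ge.
have xa : pt x a < i2.
  by rewrite /i2 addrC -fl_lt // lt_neqAle le_a // andbT; apply/eqP.
(* In the right half the mirror position comes earlier, where both facets agree, and duality would
   give agreement at [a]. *)
have am : (a < m)%N.
  rewrite ltnNge; apply/negP => ma; apply: ne.
  have lt : (rev_ord a < a)%N by rewrite /=; lia.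
  by rewrite (fl_rev _ (etrans (addrC _ _) (sx a))) (fl_rev _ (etrans (addrC _ _) (sy a))) (same _ _ lt (J_opp hi1)).
have [Q [hQ yQ Qmin]] := J_next (pt y a).
have i2Q : i2 < Q by lia.
pose conclude b k := forall l i, (a < l <= m)%N -> J i ->
  psum x l i + ((a < l)%N%:R - (b < l)%N%:R) * gain x a b k i +
  (if b == rev_ord a then 0 else (rev_ord b < l)%N%:R * gain x a b k (- i)) <= psum y l i.
have finish b k : (a < b)%N -> (b <= rev_ord a)%N -> ev a b k x < 0 -> conclude b k ->
    exists a b k, [/\ (a < b)%N, ev a b k x < 0 & dom (mul (refl a b k) x) y].
  move=> lab bra neg h; exists a, b, k; split=> //.
  have ab : a != b by rewrite neq_ltn lab.
  apply: dom_half (sim_refl k hx ab sx) sy _ => l i lm hi.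
  rewrite (psum_refl k l i hx sx ab).
  have -> : (rev_ord a < l)%N = false by apply/negbTE; rewrite -leqNgt /=; lia.
  have [al|la] := ltnP a l.
    by have := h l i; rewrite al lm subr0 => /(_ isT hi).
  have -> : (b < l)%N = false by apply/negbTE; rewrite -leqNgt; lia.
  have -> : (rev_ord b < l)%N = false.
    by apply/negbTE; rewrite -leqNgt; move: bra; rewrite /=; lia.
  have -> : psum x l i = psum y l i by apply: eq_psum => c cl; apply: same => //; lia.
  by rewrite subrr !mul0r; case: ifP; rewrite !addr0.
have below z i : z < Q -> J i -> fl z i <= fl (pt y a) i.
  move=> zQ hi; rewrite fl_ge //.
  have h : n%:Z * fl z i + i <= z by rewrite -fl_ge.
  by apply: Qmin; [rewrite addrC; exact: J_shift|lia].
(* If the window exceeds a full period, every position offers a value in it; the neighbour of [a]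
   then disturbs only the prefix of length [a.+1]. *)
have [wrap|nowrap] := ltP (pt x a + n%:Z) Q.
  have bn : (a.+1 < n)%N by lia.
  pose b := Ordinal bn; pose k := fl (Q - 1) (pt x b).
  have zQ : pt x b + n%:Z * k < Q.
    have : n%:Z * k + pt x b <= Q - 1 by rewrite -fl_ge.
    by lia.
  have zQ' : Q - 1 < pt x b + n%:Z * (k + 1).
    by rewrite [ltRHS]addrC -fl_lt // ltrDl ltr01.
  apply: (finish b k) => //=; first by lia.
    by rewrite /ev; move: zQ'; rewrite mulrDr mulr1; lia.
  move=> l i /andP [al lm] hi; rewrite al.
  have key : psum x a.+1 i + gain x a b k i <= psum y a.+1 i.
    by rewrite !psum_succ psum_a // /gain; have := below _ _ zQ hi; lia.
  have [->|la] := eqVneq l a.+1.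
    have -> : (b < a.+1)%N = false by rewrite /= ltnn.
    rewrite subr0 mul1r; case: eqP => [_|h]; first by rewrite addr0.
    have -> : (rev_ord b < a.+1)%N = false.
      apply/negbTE; rewrite -leqNgt /=; have : (a.+1 <> n - a.+1)%N.
        by move=> e; apply: h; apply/ord_inj.
      lia.
    by rewrite mul0r addr0.
  have -> : (b < l)%N by rewrite /=; lia.
  rewrite subrr mul0r addr0; case: ifP => _; rewrite ?addr0; first by apply: hd => //; lia.
  have -> : (rev_ord b < l)%N = false by apply/negbTE; rewrite -leqNgt /=; lia.
  by rewrite mul0r addr0; apply: hd => //; lia.
(* The element [i] of [J] between the two values guarantees that the exchange changes the facet. *)
pose meets c := exists k i, [/\ J i, pt x a < i, i <= pt x c + n%:Z * k & pt x c + n%:Z * k < Q].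
(* [fl z i - fl z Q] counts the [q] with [i <= z - n * q < Q]. Below [a] the counts for [x] and [y]
   agree, between [a] and [l] they vanish for [x], and at [a] only [y] has one. So the deficit at
   [i] exceeds that at [Q], which is nonnegative. *)
have strict l i : (a < l <= n)%N -> (forall c, (a < c < l)%N -> ~ meets c) ->
    J i -> pt x a < i -> i < Q -> psum x l i < psum y l i.
  move=> /andP [al ln] nm hi xi iQ.
  have h1 : \sum_(c < n | (c < l)%N) (fl (pt x c) i - fl (pt x c) Q + (c == a)%:R * 1) <=
            \sum_(c < n | (c < l)%N) (fl (pt y c) i - fl (pt y c) Q).
    apply: ler_sum => c cl; have [lt|lt|/ord_inj ->] := ltngtP c a.
    - by rewrite !same // -[X in _ == X]/a; case: eqP lt => [->|_]; rewrite ?ltnn // mul0r addr0.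
    - have -> : c == a = false by apply/negbTE; rewrite neq_ltn lt orbT.
      rewrite mul0r addr0; apply: (@le_trans _ _ 0); last first.
        by rewrite subr_ge0; apply: fl_anti; lia.
      rewrite subr_le0 leNgt; apply/negP => h; apply: (nm c); first by rewrite lt.
      exists (- fl (pt x c) i), i; split=> //.
        have : n%:Z * fl (pt x c) i + i <= pt x c by rewrite -fl_ge.
        by rewrite mulrN; lia.
      have : pt x c < n%:Z * fl (pt x c) i + Q by rewrite -fl_lt.
      by rewrite mulrN; lia.
    rewrite eqxx mul1r.
    have -> : fl (pt x a) i = -1 by apply: fl_eq => //; lia.
    have -> : fl (pt x a) Q = -1 by apply: fl_eq => //; lia.
    have : 0 <= fl (pt y a) i by rewrite fl_ge // mulr0 add0r; apply: Qmin.
    have : fl (pt y a) Q < 0 by rewrite fl_lt // mulr0 add0r.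
    by lia.
  move: h1 (hd l Q ln hQ); rewrite big_split sum_delta al !sumrB /=.
  by rewrite -/(psum x l i) -/(psum x l Q) -/(psum y l i) -/(psum y l Q); lia.
have gain01 b k : pt x a < pt x b + n%:Z * k -> pt x b + n%:Z * k < Q ->
    forall i, 0 <= gain x a b k i <= 1.
  move=> h1 h2 i; have le1 : pt x b + n%:Z * k <= pt x a + n%:Z * 1 by lia.
  have := fl_mono m_gt0 i le1; have := fl_mono m_gt0 i (ltW h1).
  by rewrite /gain (fl_shiftl _ (pt x a)) // => u1 u2; apply/andP; lia.
have bound b k l i : (a < l <= n)%N -> (forall c, (a < c < l)%N -> ~ meets c) ->
    pt x a < pt x b + n%:Z * k -> pt x b + n%:Z * k < Q -> J i ->
    psum x l i + gain x a b k i <= psum y l i.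
  move=> /andP [al ln] nm h1 h2 hi; have [g0 g1] := andP (gain01 b k h1 h2 i).
  have [e|g] := eqVneq (gain x a b k i) 0; first by rewrite e addr0; exact: hd.
  have {}g : 0 < gain x a b k i by lia.
  move: (g); rewrite {1}/gain; set q := fl (_ + _) i => hq.
  have z1 : n%:Z * q + i <= pt x b + n%:Z * k by rewrite -fl_ge.
  have z2 : pt x a < n%:Z * q + i by rewrite -fl_lt //; lia.
  have := @strict l (i + n%:Z * q) _ nm (J_shift q hi).
  have [z3 z4] : pt x a < i + n%:Z * q /\ i + n%:Z * q < Q by lia.
  by rewrite al ln !psum_shift // => /(_ isT z3 z4); lia.
(* Without such a position [strict] would hold for the full sum, but totals depend only on the
   similitude. *)
have [b0 [[b0gt mb0] b0min]] : exists b, ((a < b)%N /\ meets b) /\ forall c, (c < b)%N -> ~ ((a < c)%N /\ meets c).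
  apply: ord_least; apply: NNPP => no.
  have := @strict n i2; rewrite ltn_ord leqnn => /(_ isT) h.
  have : psum x n i2 < psum y n i2.
    by apply: h => // c /andP [ac _] mc; apply: no; exists c.
  by rewrite !(@psum_total _ K) // ltxx.
have {}b0min c : (a < c < b0)%N -> ~ meets c by move=> /andP [h1 h2] h3; apply: (b0min c).
have b0rev : (b0 <= rev_ord a)%N.
  rewrite leqNgt; apply/negP => lt.
  have an : (a <= n)%N by lia.
  have := @strict (n - a)%N i2.
  have -> : (a < n - a <= n)%N by lia.
  move=> /(_ isT) h; have {}h : psum x (n - a) i2 < psum y (n - a) i2.
    by apply: h => // c hc; apply: b0min; move: lt hc; rewrite /=; lia.
  have := psum_dual i2 sx sy an; rewrite (psum_a (- i2)); last exact: J_opp.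
  by lia.
have [k0 [i0 [hi0 xi0 iz0 z0Q]]] := mb0.
have xz0 : pt x a < pt x b0 + n%:Z * k0 by lia.
have ev_neg b k : pt x a < pt x b + n%:Z * k -> ev a b k x < 0 by rewrite /ev; lia.
have [b0m|mb] := ltnP b0 m.
  apply: (finish b0 k0) => //; first exact: ev_neg.
  move=> l i /andP [al lm] hi; rewrite al.
  have -> : (rev_ord b0 < l)%N = false by apply/negbTE; rewrite -leqNgt /=; lia.
  rewrite mul0r; have -> : (if b0 == rev_ord a then 0 else 0) = 0 :> int by case: ifP.
  rewrite addr0; have [bl|lb] := ltnP b0 l.
    by rewrite subrr mul0r addr0; apply: hd => //; lia.
  rewrite subr0 mul1r; apply: bound => //; first by lia.
  by move=> c hc; apply: b0min; lia.
have [[k1 [i3 [hi3 xi3 iz3 z3Q]]]|nora] := classic (meets (rev_ord a)).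
  have xz3 : pt x a < pt x (rev_ord a) + n%:Z * k1 by lia.
  apply: (finish (rev_ord a) k1) => //; [by rewrite /=; lia|exact: ev_neg|].
  move=> l i /andP [al lm] hi; rewrite al eqxx addr0.
  have -> : (rev_ord a < l)%N = false by apply/negbTE; rewrite -leqNgt /=; lia.
  rewrite subr0 mul1r; apply: bound => //; first by lia.
  by move=> c hc; apply: b0min; lia.
have b0ne : b0 != rev_ord a by apply/eqP=> e; apply: nora; rewrite -e.
have b0lt : (b0 < rev_ord a)%N by rewrite ltn_neqAle b0rev andbT; exact: b0ne.
apply: (finish b0 k0) => //; first exact: ev_neg.
move=> l i /andP [al lm] hi; rewrite al (negbTE b0ne).
have -> : (b0 < l)%N = false by apply/negbTE; rewrite -leqNgt; lia.
rewrite subr0 mul1r.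
have bl : psum x l i + gain x a b0 k0 i <= psum y l i.
  by apply: bound => //; [lia|move=> c hc; apply: b0min; lia].
have [lr|lr] := ltnP (rev_ord b0) l; last by rewrite mul0r addr0.
rewrite mul1r.
have bl' : gain x a b0 k0 (- i) <= psum y l i - psum x l i.
  have ln : (l <= n)%N by lia.
  have := psum_dual (- i) sx sy ln; rewrite opprK => <-.
  have := @bound b0 k0 (n - l)%N (- i).
  have -> : (a < n - l <= n)%N by lia.
  move=> /(_ isT) h; have : psum x (n - l) (- i) + gain x a b0 k0 (- i) <= psum y (n - l) (- i).
    apply: h => //; last exact: J_opp.
    by move=> c hc; apply: b0min; move: lr hc; rewrite /=; lia.
  by lia.
have [g0 g1] := andP (gain01 b0 k0 xz0 z0Q i).
have [g0' g1'] := andP (gain01 b0 k0 xz0 z0Q (- i)).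
have [//|le2] := leP (psum x l i + (gain x a b0 k0 i + gain x a b0 k0 (- i))) (psum y l i).
  by rewrite addrA.
have p1 : 0 < gain x a b0 k0 i by lia.
have p2 : 0 < gain x a b0 k0 (- i) by lia.
have reach j : J j -> 0 < gain x a b0 k0 j -> exists q,
    pt x a < j + n%:Z * q <= pt x b0 + n%:Z * k0.
  rewrite /gain; set q := fl (_ + _) j => hj hq; exists q.
  have z1 : n%:Z * q + j <= pt x b0 + n%:Z * k0 by rewrite -fl_ge.
  have z2 : pt x a < n%:Z * q + j by rewrite -fl_lt //; lia.
  by apply/andP; lia.
have [q1 /andP [r1 r2]] := reach _ hi p1; have [q2 /andP [r3 r4]] := reach _ (J_opp hi) p2.
have ha := sx a; have hb := sx b0.
(* If both gains equal 1 and together overshoot, a translate of the value at [rev_ord a] lies above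
   [pt x a]; since that position offers nothing, it must reach [Q]. Mirroring this makes
   [rev_ord b0], which precedes [b0], offer a value. *)
have yQ' : Q <= pt x (rev_ord a) + n%:Z * (q1 + q2 - K - 1).
  rewrite leNgt; apply/negP => lt; apply: nora.
  exists (q1 + q2 - K - 1), (i + n%:Z * q1); split=> //; first exact: J_shift.
  by move: r3; rewrite !mulrBr mulrDr; lia.
apply: False_ind; apply: (b0min (rev_ord b0)); first by move: b0lt; rewrite /=; lia.
exists (q1 + q2 - K - 1 - k0), (- Q + n%:Z * (q1 + q2)); split.
- exact/J_shift/J_opp.
- by move: yQ'; rewrite !mulrBr mulrDr; lia.
- by move: z0Q; rewrite !mulrBr mulrDr; lia.
by move: r1 r2 r3 r4; rewrite !mulrBr mulrDr; lia.
Qed.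
End SemiInfiniteOrder.

(** * Permissible cosets are admissible *)

Section PermissibleIsAdmissible.
Variable m : nat.
Hypothesis m_gt0 : (0 < m)%N.
Local Notation n := (m.*2).
Local Notation fl := (@fl m).
Implicit Types (x y w : elt n) (a b c : 'I_n) (i k q K : int) (l : nat).

(** The semi-infinite order: [k] is unrestricted, and positivity of the finite root replaces the
    comparison with [A]. *)
Inductive climb : elt n -> elt n -> Prop :=
| climb_refl x : climb x x
| climb_step x y a b k : (a < b)%N -> ev a b k x < 0 ->
    climb (mul (refl a b k) x) y -> climb x y.

Lemma climb_Wt x y : inWt x -> climb x y -> inWt y.
Proof.
move=> + h; elim: h => // {}x {}y a b k ab _ _ IH hx; apply: IH.
by apply: Wt_mul hx; apply: Wt_refl; rewrite neq_ltn ab.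
Qed.

(* translation by [N] times an antidominant regular coweight *)
Definition deep (N : nat) : elt n := transl [ffun c : 'I_n => - (N * c)%N%:Z].

Lemma deep_Wt N : inWt (deep N).
Proof.
by apply: Wt_transl => a b; rewrite !ffunE !PoszM !rev_ordE; ring.
Qed.

Lemma climb_ble x y : inWt x -> climb x y -> exists N0 : nat, forall N, (N0 <= N)%N ->
  ble (mul (deep N) x) (mul (deep N) y).
Proof.
move=> + h; elim: h => [z _|{}x {}y a b k ab lt _ IH hx].
  by exists 0%N => N _; exact: ble_refl.
have ab' : a != b by rewrite neq_ltn ab.
have [N0 h] := IH (Wt_mul (Wt_refl k ab') hx).
(* [N > |k|] makes the translated hyperplane negative at the base point, whatever the sign of
   [k]. *)
exists (maxn N0 (absz k).+1) => N; rewrite geq_max => /andP [le1 le2].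
apply: ble_step (h N le1).
have st z : (deep N).2 z = z by rewrite perm1.
rewrite (refl_conj k (deep_Wt N) hx ab').
do 3!eexists; split; [|reflexivity| |].
- by rewrite !st.
- rewrite !st !ffunE ev_one.
  have hb := ltn_ord b; have ha := ltn_ord a.
  have e : 1 <= k - (N * a)%N%:Z - - (N * b)%N%:Z by rewrite !PoszM; nia.
  by nia.
by rewrite -(refl_conj k (deep_Wt N) hx ab') ev_mul ev_refl // oppr_gt0.
Qed.

Section Facet.
Variable I : {set 'I_m.+1}.
Hypothesis I_neq0 : I != set0.
Local Notation J := (inPMI I).
Local Notation dom := (dom I).

(** Raising terminates: positive coroots have nonnegative prefix sums, so [P] strictly increases,
    while domination at one vertex [i0] bounds it. *)
Lemma dom_climb x y K : inWt x -> has_sim x K -> has_sim y K -> dom x y ->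
  exists2 z, climb x z & forall i c, J i -> fl (pt z c) i = fl (pt y c) i.
Proof.
move=> hx sx sy hd; have [i0 hi0] := J_ex I_neq0.
pose P w : int := \sum_(l < n) \sum_(c < n | (c < l)%N) pt w c.
have Pbound : exists B : int, forall w, dom w y -> P w <= B.
  exists (\sum_(l < n) (n%:Z * psum y l i0 + \sum_(c < n | (c < l)%N) (n%:Z + i0))) => w hw.
  apply: ler_sum => l _; apply: (@le_trans _ _ (n%:Z * psum w l i0 + \sum_(c < n | (c < l)%N) (n%:Z + i0))).
    rewrite mulr_sumr -big_split /=; apply: ler_sum => c _.
    have : pt w c < n%:Z * (fl (pt w c) i0 + 1) + i0 by rewrite -fl_lt // ltrDl.
    by rewrite mulrDr mulr1; lia.
  rewrite lerD2r ler_pM2l; last by lia.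
  by apply: hw => //; have := ltn_ord l; lia.
have Pgrow w a b k : inWt w -> (a < b)%N -> ev a b k w < 0 -> P w < P (mul (refl a b k) w).
  move=> hw ab lt; have ab' : a != b by rewrite neq_ltn ab.
  have e (l : 'I_n) : \sum_(c < n | (c < l)%N) pt (mul (refl a b k) w) c =
     \sum_(c < n | (c < l)%N) pt w c - ev a b k w * \sum_(c < n | (c < l)%N) coroot a b c.
    by rewrite mulr_sumr -sumrB; apply: eq_bigr => c _; rewrite pt_refl.
  have co l : \sum_(c < n | (c < l)%N) coroot a b c =
     (a < l)%N%:R - (b < l)%N%:R +
     (if b == rev_ord a then 0 else (rev_ord b < l)%N%:R - (rev_ord a < l)%N%:R).
    rewrite /coroot big_split sumrB /=.
    have d c0 : \sum_(c < n | (c < l)%N) (c == c0)%:R = (c0 < l)%N%:R :> int.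
      by have := sum_delta c0 l 1; rewrite mulr1 => <-; apply: eq_bigr => c _; rewrite mulr1.
    rewrite !d; congr (_ + _); case: eqP => _; first by rewrite big1.
    by rewrite sumrB !d.
  have co0 l : 0 <= \sum_(c < n | (c < l)%N) coroot a b c.
    rewrite co; have r : (rev_ord b < rev_ord a)%N by rewrite /=; have := ltn_ord b; lia.
    have -> : (a < l)%N = (b < l)%N || (a < l <= b)%N by lia.
    have -> : (rev_ord b < l)%N = (rev_ord a < l)%N || (rev_ord b < l <= rev_ord a)%N.
      by move: r => /=; lia.
    by case: (b < l)%N; case: (a < l <= b)%N; case: ifP => _; case: (_ < l)%N; case: (_ < l <= _)%N.
  have bn : (a.+1 < n)%N by have := ltn_ord b; lia.
  have co1 : 1 <= \sum_(c < n | (c < a.+1)%N) coroot a b c.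
    rewrite co ltnS leqnn.
    have -> : (b < a.+1)%N = false by lia.
    have r : (rev_ord b < rev_ord a)%N by rewrite /=; have := ltn_ord b; lia.
    case: ifP => _ //.
    have -> : (rev_ord b < a.+1)%N = (rev_ord a < a.+1)%N || (rev_ord b < a.+1 <= rev_ord a)%N.
      by move: r => /=; lia.
    by case: (_ < _)%N; case: (_ < _ <= _)%N.
  rewrite /P; under [ltRHS]eq_bigr do rewrite e.
  rewrite sumrB ltrDl oppr_gt0 -mulr_sumr nmulr_rlt0 //.
  rewrite (bigD1 (Ordinal bn)) //=; apply: ltr_pwDl; first exact: lt_le_trans ltr01 co1.
  by apply: sumr_ge0 => l _; exact: co0.
have [B hB] := Pbound.
have [N] := ubnP (absz (B - P x)%R).
elim: N x hx sx hd => // N IH x hx sx hd lt.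
have [ex|nex] := classic (exists c i, J i /\ fl (pt x c) i <> fl (pt y c) i); last first.
  exists x; first exact: climb_refl.
  by move=> i c hi; apply: NNPP => h; apply: nex; exists c, i.
have [a [b [k [ab neg hd']]]] := dom_raise m_gt0 I_neq0 hx sx sy hd ex.
have ab' : a != b by rewrite neq_ltn ab.
have [|z cz ez] := IH _ (Wt_mul (Wt_refl k ab') hx) (sim_refl k hx ab' sx) hd'.
  by have := Pgrow x a b k hx ab neg; have := hB _ hd; have := hB _ hd'; lia.
by exists z => //; exact: climb_step cz.
Qed.
End Facet.

(** Breaking ties by the index makes the keys distinct and keeps dual keys of constant sum, so the
    ranks of dual positions are dual. *)
Lemma sort_sim (d : 'I_n -> int) :
  (forall a b, d a + d (rev_ord a) = d b + d (rev_ord b)) ->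
  exists2 tau : {perm 'I_n}, inSstar tau & forall a b, (a <= b)%N -> d (tau b) <= d (tau a).
Proof.
move=> hd.
pose key c : int := (c : nat)%:Z - n%:Z * d c.
have key_rev a b : key a + key (rev_ord a) = key b + key (rev_ord b).
  by have := hd a b; rewrite /key !rev_ordE => e; nia.
have key_inj : injective key.
  move=> a b e; have ha := ltn_ord a; have hb := ltn_ord b.
  have e1 : (a : nat)%:Z - (b : nat)%:Z = n%:Z * (d a - d b).
    by move: e; rewrite /key mulrBr; lia.
  have e2 : d a - d b = 0 by apply: small_multiple_eq0 e1 _ _; lia.
  by apply/ord_inj; move: e1; rewrite e2 mulr0; lia.
pose rank c := #|[set j | key j < key c]|.
have rank_mono a b : key a < key b -> (rank a < rank b)%N.
  move=> lt; apply: proper_card; apply/properP; split.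
    by apply/subsetP => j; rewrite !inE => /lt_trans; apply.
  by exists a; rewrite !inE ?ltxx.
have rank_ub c : (rank c < n)%N.
  rewrite -[X in (_ < X)%N](card_ord n) -cardsT; apply: proper_card.
  by apply/properP; split; [exact: subsetT|exists c; rewrite !inE ?ltxx].
pose f c := Ordinal (rank_ub c).
have f_inj : injective f.
  move=> a b /(congr1 val) /= e; apply: key_inj.
  have [lt|lt|//] := ltgtP (key a) (key b).
    by have := rank_mono _ _ lt; rewrite e ltnn.
  by have := rank_mono _ _ lt; rewrite e ltnn.
have f_rev c : f (rev_ord c) = rev_ord (f c).
  apply/ord_inj => /=.
  have -> : rank (rev_ord c) = #|[set j | key c < key j]|.
    rewrite /rank -[RHS](card_imset _ (@rev_ord_inj n)); apply: eq_card => j.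
    rewrite -[j]rev_ordK (mem_imset _ _ (@rev_ord_inj n)) !inE.
    by have := key_rev c (rev_ord j); rewrite rev_ordK; lia.
  have := cardsC [set j | key j <= key c].
  have -> : #|[set j | key j <= key c]| = (rank c).+1.
    rewrite (cardsD1 c) inE lexx add1n /rank; congr _.+1; apply: eq_card => j.
    rewrite !inE lt_neqAle; case: (j =P c) => [->|jc]; first by rewrite eqxx.
    by have -> : key j == key c = false by apply/eqP => /key_inj.
  have -> : ~: [set j | key j <= key c] = [set j | key c < key j].
    by apply/setP => j; rewrite !inE ltNge.
  by rewrite card_ord; lia.
pose p := perm f_inj.
have p_star : inSstar p by move=> c; rewrite !permE f_rev.
exists (p^-1)%g; first exact: Sstar_inv.
move=> a b ab; set u := (p^-1)%g a; set v := (p^-1)%g b.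
have eu : rank u = a by have /(congr1 val) := permKV p a; rewrite permE.
have ev : rank v = b by have /(congr1 val) := permKV p b; rewrite permE.
have le : key u <= key v.
  by rewrite leNgt; apply/negP => /rank_mono; rewrite eu ev; lia.
have hu := ltn_ord u; have hv := ltn_ord v.
by move: le; rewrite /key; nia.
Qed.

(** This supplies the hypothesis of [ble_strip]. Such a hyperplane forces [tau^-1 a < tau^-1 b], and
    the sorted displacement then makes the root at least as large on [w] as at the base point. *)
Lemma deep_separates N (tau : {perm 'I_n}) w a b k :
  (0 < N)%N -> a != b ->
  (forall c c' : 'I_n, (c <= c')%N ->
     pt w (tau c') - (tau c' : nat)%:Z <= pt w (tau c) - (tau c : nat)%:Z) ->
  0 < ev a b k (one n) ->
  ev a b k (inv (mul (deep N) ([ffun=> 0], (tau^-1)%g))) < 0 -> 0 < ev a b k w.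
Proof.
move=> N0 ab acute; rewrite ev_one.
have pE c : pt (inv (mul (deep N) ([ffun=> 0], (tau^-1)%g))) c =
    (n%:Z * N%:Z + 1) * ((tau^-1)%g c : nat)%:Z.
  rewrite invM pt_mul /pt /= !ffunE /= !invgK !perm1 PoszM.
  by ring.
rewrite {1}/ev !pE => pos neg.
set p := (tau^-1)%g a in neg; set q := (tau^-1)%g b in neg.
have ha := ltn_ord a; have hb := ltn_ord b.
have pq : (p < q)%N.
  have ne : (p : nat) <> q by move/ord_inj/perm_inj => e; rewrite e eqxx in ab.
  rewrite ltnNge; apply/negP => le.
  have e1 : 1 <= (p : nat)%:Z - (q : nat)%:Z by lia.
  have e2 : n%:Z <= n%:Z * N%:Z by rewrite ler_peMr //; lia.
  have e3 : n%:Z * N%:Z + 1 <= (n%:Z * N%:Z + 1) * ((p : nat)%:Z - (q : nat)%:Z).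
    by rewrite ler_peMr //; lia.
  by move: neg pos e3; rewrite mulrBr; lia.
have := acute p q (ltnW pq); rewrite !permKV /ev; lia.
Qed.

Variable I : {set 'I_m.+1}.
Hypothesis I_neq0 : I != set0.

Lemma Perm_Adm (mu : vec n) w : inX mu -> inWt w -> PermGL I mu w -> Adm I mu w.
Proof.
move=> hmu hw perm_w.
have [rho rho_s rho_mono] := sort_sim hmu.
have [|tau tau_s tau_mono] := @sort_sim (fun c => pt w c - (c : nat)%:Z).
  by move=> a b; have := pt_dual a b hw; rewrite !rev_ordE; lia.
(* Chosen so that [lam] read along [tau] is [mu] read along [rho], hence decreasing: [lam] is
   dominant for the chamber of the displacement. *)
pose s := (rho^-1 * tau)%g.
have s_s : inSstar s by apply: Sstar_mul => //; exact: Sstar_inv.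
pose lam := permv s mu.
have lamE c : lam (tau c) = mu (rho c) by rewrite ffunE invMg invgK permM permK.
have lamX : inX lam.
  by move=> a b; rewrite !ffunE !(Sstar_inv s_s).
exists s => //; rewrite -/lam.
have ht := Wt_transl lamX.
pose u : elt n := ([ffun=> 0], (tau^-1)%g).
have hu : inWt u.
  by split; [move=> a b; rewrite !ffunE|exact: Sstar_inv].
pose x := mul u w; pose y := mul u (transl lam).
have hx : inWt x by exact: Wt_mul. have hy : inWt y by exact: Wt_mul.
have ptu z c : pt (mul u z) c = pt z (tau c).
  by rewrite pt_mul /= ffunE mulr0 add0r invgK.
pose D i : vec n := [ffun j => act w (omega n i) j - omega n i j].
have flx i c : fl (pt x c) i = D i (tau c) + omega n i (tau c).
  by rewrite /x ptu -act_omega // [D i _]ffunE subrK.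
have fly i c : fl (pt y c) i = mu (rho c) + omega n i (tau c).
  by rewrite /y ptu -act_omega // [LHS]ffunE /= invg1 perm1 -lamE.
have hdom : dom I x y.
  move=> l i ln hi; rewrite /psum; under eq_bigr do rewrite flx.
  under [leRHS]eq_bigr do rewrite fly.
  rewrite !big_split lerD2r /=; exact: conv_prefix (perm_w i hi).
have [K sx] := exists_sim m_gt0 hx; have [K' sy] := exists_sim m_gt0 hy.
(* Convex combinations of permutations of [mu] keep the coordinate sum, which determines the
   similitude. *)
have KK : K' = K.
  have [i hi] := J_ex I_neq0.
  have : psum x n i = psum y n i.
    rewrite /psum; under eq_bigr do rewrite flx.
    under [RHS]eq_bigr do rewrite fly.
    rewrite !big_split /=; congr (_ + _).
    have e (F : 'I_n -> int) : \sum_(c < n | (c < n)%N) F c = \sum_c F c.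
      by apply: eq_bigl => c; rewrite ltn_ord.
    have r (v : vec n) (p : {perm 'I_n}) : \sum_c v (p c) = \sum_c v c.
      by rewrite [RHS](reindex_inj (@perm_inj _ p)).
    rewrite !e (r (D i)) (r mu).
    exact: conv_total (perm_w i hi).
  rewrite (psum_total m_gt0 i sx) (psum_total m_gt0 i sy) => /addIr.
  by move/mulfI => -> //; lia.
rewrite KK in sy.
have [z cz ez] := dom_climb I_neq0 hx sx sy hdom.
have hz := climb_Wt hx cz.
have [N0 h0] := climb_ble hx cz.
pose N := N0.+1; have {h0} := h0 N (leqnSn N0).
pose y1 := mul (inv u) z.
have hy1 : inWt y1 by apply: Wt_mul hz; exact: Wt_inv.
have -> : z = mul u y1 by rewrite /y1 mulKVw.
rewrite /x (mulA _ u w) (mulA _ u y1) => hb.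
have low : ble w y1.
  apply: ble_strip hb => //; first exact: Wt_mul (deep_Wt N) hu.
  by move=> a b k ab; exact: deep_separates.
apply: (bruhatI_intro m_gt0 I_neq0 hw ht (coset_refl I w) _ low).
(* [z] and [y] share only the vertices indexed by [J], which is exactly what places [y1] in the
   coset of [transl lam]. *)
exists (mul (inv (transl lam)) y1); last by rewrite mulKVw.
split; first by apply: Wt_mul hy1; exact: Wt_inv.
move=> i hi; apply: (etrans _ (_ : act (inv (transl lam)) (act (transl lam) (omega n i)) = _)).
  rewrite act_mul; congr act; rewrite /y1 act_mul.
  have -> : act z (omega n i) = act y (omega n i).
    by apply/ffunP => c; rewrite !act_omega // ez.
  by rewrite -act_mul /y mulKw.
by rewrite -act_mul mulVw act_one.
Qed.
End PermissibleIsAdmissible.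

(* Adm_{GSp_{2m},I}(mu) = Perm_{GL_{2m},+-I}(mu) /\ W~/W_I : for every
   w in W~, the coset w W_I is admissible iff its image w W_{GL,+-I}
   lies in Perm_{GL_{2m},+-I}(mu). *)
Theorem theorem6p3p2 (m : nat) (I : {set 'I_m.+1}) (mu : vec m.*2) :
  (0 < m)%N -> I != set0 -> inX mu ->
  forall w : elt m.*2, inWt w -> (Adm I mu w <-> PermGL I mu w).
Proof.
by move=> m_gt0 I_neq0 hmu w hw; split; [exact: Adm_Perm | exact: Perm_Adm].
Qed.
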